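(* Let $\mathfrak g$ be a finite-dimensional simple classical Lie algebra over $\mathbb C$ (one of $\mathfrak{sl}(n)$, $\mathfrak{so}(n)$, $\mathfrak{sp}(2n)$) and $\overline{\mathfrak g}$ the associated infinite-dimensional Lax operator algebra with its almost-grading. Every local cocycle on $\overline{\mathfrak g}$ is cohomologous, up to rescaling, to a uniquely defined cocycle which is bounded from above by zero; that is, there is a cocycle $\gamma_0$ bounded from above by zero such that every local cocycle is cohomologous to a scalar multiple of $\gamma_0$. In particular, the space of local cohomology classes is at most one-dimensional, and up to equivalence and rescaling there is at most one non-trivial local cohomology class.
   Context: Setting. $\Sigma$ is a compact Riemann surface of genus $g$ with two distinct marked points $P_+,P_-$; $n\in\mathbb N$; $W=\{\gamma_1,\dots,\gamma_{ng}\}\subset\Sigma\setminus\{P_+,P_-\}$ is a set of $ng$ further points, all marked points being in generic position; $z_\pm,z_s$ are fixed local coordinates centred at $P_\pm,\gamma_s$. $\mathfrak g$ is one of $\mathfrak{sl}(n)$, $\mathfrak{so}(n)$ (skew-symmetric matrices), $\mathfrak{sp}(2n)=\{X: X^t\sigma+\sigma X=0\}$ ($\sigma$ a nondegenerate skew-symmetric $2n\times 2n$ matrix). To each $\gamma_s$ a vector $\alpha_s\in\mathbb C^n$ is attached ($\alpha_s\in\mathbb C^{2n}$ for $\mathfrak{sp}(2n)$; $\alpha_s^t\alpha_s=0$ for $\mathfrak{so}(n)$). Lax operator algebra. $\overline{\mathfrak g}$ is the Lie algebra, under the pointwise commutator, of all meromorphic $L:\Sigma\to\mathfrak g$, holomorphic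 outside $W\cup\{P_+,P_-\}$, whose Laurent expansion $L=\sum_k L_{s,k}z_s^k$ at each $\gamma_s$ satisfies: for $\mathfrak{sl}(n)$: $L_{s,k}=0$ for $k<-1$ and there are $\beta_s\in\mathbb C^n,\kappa_s\in\mathbb C$ with $L_{s,-1}=\alpha_s\beta_s^t$, $\beta_s^t\alpha_s=0$, $L_{s,0}\alpha_s=\kappa_s\alpha_s$; for $\mathfrak{so}(n)$: the same with $L_{s,-1}=\alpha_s\beta_s^t-\beta_s\alpha_s^t$; for $\mathfrak{sp}(2n)$: $L_{s,k}=0$ for $k<-2$ and there are $\beta_s\in\mathbb C^{2n},\nu_s,\kappa_s\in\mathbb C$ with $L_{s,-2}=\nu_s\alpha_s\alpha_s^t\sigma$, $L_{s,-1}=(\alpha_s\beta_s^t+\beta_s\alpha_s^t)\sigma$, $\beta_s^t\sigma\alpha_s=0$, $L_{s,0}\alpha_s=\kappa_s\alpha_s$, $\alpha_s^t\sigma L_{s,1}\alpha_s=0$. Almost-grading. If some $\alpha_s\ne0$, then $\overline{\mathfrak g}=\bigoplus_{m\in\mathbb Z}\overline{\mathfrak g}_m$ with $\overline{\mathfrak g}_m=\{L\in\overline{\mathfrak g}: \exists X_\pm\in\mathfrak g,\ L=X_+z_+^m+O(z_+^{m+1})\text{ at }P_+,\ L=X_-z_-^{-m-g}+O(z_-^{-m-g+1})\text{ at }P_-\}$. If all $\alpha_s=0$, then $\overline{\mathfrak g}=\mathfrak g\otimes\mathcal A$, $\overline{\mathfrak g}_m=\mathfrak g\otimes A_m$, where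 $\mathcal A=\bigoplus_m\mathbb C A_m$ is the algebra of meromorphic functions on $\Sigma$ holomorphic outside $\{P_+,P_-\}$ with its Krichever–Novikov basis: $A_m=z_+^m+O(z_+^{m+1})$ at $P_+$, with complementary order at $P_-$ equal to $-m-g$ for $m\ge1$ or $m\le-g-1$ (adapted for the finitely many other $m$). Known: $\dim\overline{\mathfrak g}_m=\dim\mathfrak g$; for $X\in\mathfrak g$ there is a unique $X_m\in\overline{\mathfrak g}_m$ with $X_m=Xz_+^m+O(z_+^{m+1})$; and there is $M$ with $[\overline{\mathfrak g}_m,\overline{\mathfrak g}_k]\subseteq\bigoplus_{h=m+k}^{m+k+M}\overline{\mathfrak g}_h$. Cocycles. A (2-)cocycle is an antisymmetric bilinear form $\gamma:\overline{\mathfrak g}\times\overline{\mathfrak g}\to\mathbb C$ with $\gamma([L,L'],L'')+\gamma([L',L''],L)+\gamma([L'',L],L')=0$; two cocycles are cohomologous if their difference has the form $(L,L')\mapsto\phi([L,L'])$ for a linear form $\phi$ on $\overline{\mathfrak g}$. $\gamma$ is local if there are $R,S\in\mathbb Z$ such that $\gamma(\overline{\mathfrak g}_n,\overline{\mathfrak g}_m)\neq0$ implies $R\le n+m\le S$. $\gamma$ is bounded from above by zero if $\gamma(\overline{\mathfrak g}_n,\overline{\mathfrak g}_m)=0$ whenever $n+m>0$. A cohomology class is local if it has a local representative. *)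

(* Defs.v *)
From HB Require Import structures.
From mathcomp Require Import all_boot all_order all_algebra.
From mathcomp Require Import complex.
From mathcomp Require Import all_classical all_reals all_analysis.

Set Implicit Arguments.
Unset Strict Implicit.
Unset Printing Implicit Defensive.

Import Order.TTheory GRing.Theory Num.Theory.
Import numFieldNormedType.Exports.

Local Open Scope classical_set_scope.
Local Open Scope ring_scope.

(* Everything below is written over a numClosedFieldType C, whose topology is
   the one of its norm; it is meant to be used with C := CC R.  Going through
   CC lets R[i] inherit the generic topology of a numClosedFieldType. *)
Definition CC (R : realType) : numClosedFieldType := R[i].
Arguments CC R : simpl never.

Section RiemannSurface.
Context {C : numClosedFieldType}.

Record chart (T : topologicalType) := Chart {
  chart_dom : set T;
  chart_map : T -> C;
  chart_inv : C -> T;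
  chart_dom_open : open chart_dom;
  chart_img_open : open (chart_map @` chart_dom);
  chart_mapK : forall x, chart_dom x -> chart_inv (chart_map x) = x;
  chart_map_cont : {within chart_dom, continuous chart_map};
  chart_inv_cont : {within chart_map @` chart_dom, continuous chart_inv} }.

(* Over C, derivability in the direction 1 is complex differentiability. *)
Definition cderivable (f : C -> C) (w : C) : Prop := derivable f w 1.

Definition transition (T : topologicalType) (c1 c2 : chart T) : C -> C :=
  chart_map c2 \o chart_inv c1.

Definition compatible (T : topologicalType) (c1 c2 : chart T) : Prop :=
  forall x, chart_dom c1 x -> chart_dom c2 x ->
    cderivable (transition c1 c2) (chart_map c1 x) /\
    cderivable (transition c2 c1) (chart_map c2 x).

Record riemann_surface := RiemannSurface {
  surface :> topologicalType;
  atlas : set (chart surface);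
  atlas_cover : forall x, exists2 c, atlas c & chart_dom c x;
  atlas_compatible :
    forall c1 c2, atlas c1 -> atlas c2 -> compatible c1 c2;
  surface_hausdorff : hausdorff_space surface;
  surface_compact : compact [set: surface];
  surface_connected : connected [set: surface] }.

Definition local_coordinate (S : riemann_surface) (P : S) (z : chart S) :=
  [/\ forall c, atlas c -> compatible z c, chart_dom z P & chart_map z P = 0].

Definition holomorphic_on (S : riemann_surface) (D : set S) (f : S -> C) :=
  forall c x, atlas c -> chart_dom c x -> D x ->
    cderivable (f \o chart_inv c) (chart_map c x).

(* A holomorphic 1-form is given by its coefficients: it reads om c w dw in
   the chart c.  The coefficients are only relevant on the image of c. *)
Definition holomorphic_form (S : riemann_surface)
    (om : chart S -> C -> C) : Prop :=
  (forall c x, atlas c -> chart_dom c x -> cderivable (om c) (chart_map c x)) /\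
  (forall c1 c2 x, atlas c1 -> atlas c2 -> chart_dom c1 x -> chart_dom c2 x ->
     om c1 (chart_map c1 x) =
     om c2 (chart_map c2 x) * 'D_1 (transition c1 c2) (chart_map c1 x)).

(* The genus is the dimension of the space of holomorphic 1-forms. *)
Definition has_genus (S : riemann_surface) (g : nat) : Prop :=
  exists2 w : 'I_g -> chart S -> C -> C,
    forall i, holomorphic_form (w i) &
    forall om, holomorphic_form om ->
      exists! a : 'rV[C]_g, forall c x, atlas c -> chart_dom c x ->
        om c (chart_map c x) = \sum_(i < g) a 0 i * w i c (chart_map c x).

(* f = \sum_(k >= p) a_k z^k in a punctured neighbourhood of z = 0 *)
Definition laurent (S : riemann_surface) (z : chart S) (f : S -> C)
    (p : int) (a : int -> C) : Prop :=
  \forall w \near (0 : C)^',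
    series (fun k : nat => a (p + k%:Z) * w ^ (p + k%:Z)) @ \oo
      --> f (chart_inv z w).

Definition meromorphic_at (S : riemann_surface) (z : chart S) (f : S -> C) :=
  exists p a, laurent z f p a.

(* f = a z^m + O(z^(m+1)) at z = 0 *)
Definition leading (S : riemann_surface) (z : chart S) (f : S -> C)
    (m : int) (a : C) : Prop :=
  exists K : C, \forall w \near (0 : C)^',
    `|f (chart_inv z w) - a * w ^ m| <= K * `|w ^ (m + 1)|.

End RiemannSurface.
Arguments chart : clear implicits.
Arguments riemann_surface : clear implicits.

Section Cocycles.
Context {C : fieldType} {V : lmodType C}.
(* G is the subspace of V underlying a Lie algebra with bracket br. *)
Variables (br : V -> V -> V) (G : set V).

Definition cocycle (ga : V -> V -> C) : Prop :=
  [/\ forall a L1 L2 L, G L1 -> G L2 -> G L ->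
        ga (a *: L1 + L2) L = a * ga L1 L + ga L2 L,
      forall L L', G L -> G L' -> ga L L' = - ga L' L &
      forall L L' L'', G L -> G L' -> G L'' ->
        ga (br L L') L'' + ga (br L' L'') L + ga (br L'' L) L' = 0].

Definition linear_form_on (phi : V -> C) : Prop :=
  forall a L L', G L -> G L' -> phi (a *: L + L') = a * phi L + phi L'.

Definition cohomologous (ga ga' : V -> V -> C) : Prop :=
  exists2 phi, linear_form_on phi &
    forall L L', G L -> G L' -> ga L L' - ga' L L' = phi (br L L').

(* Gr m is the homogeneous subspace of degree m. *)
Variable Gr : int -> set V.

Definition local (ga : V -> V -> C) : Prop :=
  exists lo hi : int, forall n m L L', Gr n L -> Gr m L' ->
    ga L L' != 0 -> lo <= n + m <= hi.

Definition bounded_above_by_zero (ga : V -> V -> C) : Prop :=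
  forall n m L L', 0 < n + m -> Gr n L -> Gr m L' -> ga L L' = 0.

Definition local_class (ga : V -> V -> C) : Prop :=
  exists ga', [/\ cocycle ga', local ga' & cohomologous ga ga'].

Definition scale_form (a : C) (ga : V -> V -> C) : V -> V -> C :=
  fun L L' => a * ga L L'.

(* ga0 is bounded from above by zero and its class spans all local classes. *)
Definition universal_bounded (ga0 : V -> V -> C) : Prop :=
  [/\ cocycle ga0, local_class ga0, bounded_above_by_zero ga0 &
      forall ga, cocycle ga -> local ga ->
        exists a, cohomologous ga (scale_form a ga0)].

Definition finite_family (F : int -> V) : Prop :=
  finite_set [set m | F m != 0].

(* G is the direct sum of the Gr m. *)
Definition direct_decomposition : Prop :=
  (forall m L, Gr m L -> G L) /\
  (forall L, G L -> exists! F : int -> V,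
     [/\ forall m, Gr m (F m), finite_family F &
         L = \sum_(m \in [set: int]) F m]).

(* [Gr m, Gr k] is contained in Gr (m+k) + ... + Gr (m+k+M) *)
Definition almost_graded_bracket : Prop :=
  exists M : nat, forall m k L L', Gr m L -> Gr k L' ->
    exists2 F : 'I_M.+1 -> V,
      forall i : 'I_M.+1, Gr (m + k + (i : nat)%:Z) (F i) & br L L' = \sum_i F i.

End Cocycles.

Section ClassicalAlgebras.
Context {C : fieldType}.

Variant classical_type := SL | SO | SP.

(* size of the matrices in sl(n), so(n), sp(2n) *)
Definition msize (k : classical_type) (n : nat) : nat :=
  if k is SP then (2 * n)%N else n.

Definition lie_bracket N (X Y : 'M[C]_N) : 'M[C]_N := X *m Y - Y *m X.

(* sigma is only used for sp(2n) *)
Definition classical (k : classical_type) N (sigma : 'M[C]_N) : set 'M[C]_N :=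
  match k with
  | SL => [set X | \tr X = 0]
  | SO => [set X | X^T = - X]
  | SP => [set X | X^T *m sigma + sigma *m X = 0]
  end.

Definition simple_lie_algebra N (G : set 'M[C]_N) : Prop :=
  (exists X Y, [/\ G X, G Y & lie_bracket X Y != 0]) /\
  (forall I : {vspace 'M[C]_N},
     (forall Y, Y \in I -> G Y) ->
     (forall X Y, G X -> Y \in I -> lie_bracket X Y \in I) ->
     I = 0%VS \/ (forall X, G X -> X \in I)).

End ClassicalAlgebras.

Section LaxOperators.
Context {C : numClosedFieldType}.

Record lax_data (g n : nat) (k : classical_type) := LaxData {
  lax_surface : riemann_surface C;
  lax_genus : has_genus lax_surface g;
  Pplus : lax_surface;
  Pminus : lax_surface;
  zplus : chart C lax_surface;
  zminus : chart C lax_surface;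
  weak : 'I_(n * g) -> lax_surface;
  zweak : 'I_(n * g) -> chart C lax_surface;
  Pplus_neq_Pminus : Pplus <> Pminus;
  weak_inj : injective weak;
  weak_neq_Pplus : forall s, weak s <> Pplus;
  weak_neq_Pminus : forall s, weak s <> Pminus;
  zplus_coord : local_coordinate Pplus zplus;
  zminus_coord : local_coordinate Pminus zminus;
  zweak_coord : forall s, local_coordinate (weak s) (zweak s);
  sigma : 'M[C]_(msize k n);
  sigma_skew : k = SP -> sigma^T = - sigma;
  sigma_nondeg : k = SP -> sigma \in unitmx;
  alpha : 'I_(n * g) -> 'cV[C]_(msize k n);
  alpha_isotropic : k = SO -> forall s, (alpha s)^T *m alpha s = 0 }.

Variables (g n : nat) (k : classical_type) (D : lax_data g n k).
Local Notation S := (lax_surface D).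
Local Notation N := (msize k n).
Local Notation P := (Pplus D).
Local Notation Q := (Pminus D).

Definition fin_algebra : set 'M[C]_N := classical k (sigma D).

Definition marked : set S := [set P] `|` [set Q] `|` range (@weak g n k D).

Definition entry (L : S -> 'M[C]_N) (i j : 'I_N) : S -> C := fun x => L x i j.

Definition mx_laurent (z : chart C S) (L : S -> 'M[C]_N) (p : int)
    (A : int -> 'M[C]_N) : Prop :=
  forall i j, laurent z (entry L i j) p (fun h => A h i j).

Definition mx_leading (z : chart C S) (L : S -> 'M[C]_N) (m : int)
    (X : 'M[C]_N) : Prop :=
  forall i j, leading z (entry L i j) m (X i j).

(* Conditions on the Laurent coefficients A of L at the point carrying al;
   the 1x1 matrices b^T *m a stand for scalars. *)
Definition tyurin (al : 'cV[C]_N) (A : int -> 'M[C]_N) : Prop :=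
  match k with
  | SL => exists (be : 'cV[C]_N) (ka : C),
      [/\ A (-1) = al *m be^T, be^T *m al = 0 & A 0 *m al = ka *: al]
  | SO => exists (be : 'cV[C]_N) (ka : C),
      [/\ A (-1) = al *m be^T - be *m al^T, be^T *m al = 0
        & A 0 *m al = ka *: al]
  | SP => exists (be : 'cV[C]_N) (nu ka : C),
      [/\ A (-2) = nu *: (al *m al^T *m sigma D),
          A (-1) = (al *m be^T + be *m al^T) *m sigma D,
          be^T *m sigma D *m al = 0,
          A 0 *m al = ka *: al
        & al^T *m sigma D *m A 1 *m al = 0]
  end.

Definition pole_bound : int := if k is SP then -2 else -1.

(* Meromorphic functions are total functions; those of the Lax operator
   algebra are given the dummy value 0 at all the marked points, so that they
   are equal as soon as they agree outside the marked points. *)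
Definition lax_algebra : set (S -> 'M[C]_N) := [set L |
  [/\ forall x, fin_algebra (L x),
      forall x, marked x -> L x = 0,
      forall i j, holomorphic_on (~` marked) (entry L i j),
      forall i j, meromorphic_at (zplus D) (entry L i j) /\
                  meromorphic_at (zminus D) (entry L i j)
    & forall s, exists A, mx_laurent (zweak D s) L pole_bound A /\
                          tyurin (alpha D s) A]].

Definition lax_bracket (L L' : S -> 'M[C]_N) : S -> 'M[C]_N :=
  fun x => lie_bracket (L x) (L' x).

(* the algebra of meromorphic functions with poles at P and Q only, again
   with the dummy value 0 at P and Q *)
Definition KN_algebra : set (S -> C) := [set f |
  [/\ f P = 0, f Q = 0, holomorphic_on (~` [set P; Q]) f,
      meromorphic_at (zplus D) f & meromorphic_at (zminus D) f]].

(* For the finitely many m with -g <= m <= 0 the order of A m at Q is left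
   free: any adapted choice is allowed. *)
Definition KN_basis (A : int -> S -> C) : Prop :=
  [/\ forall m, KN_algebra (A m),
      forall m, leading (zplus D) (A m) m 1,
      forall m, 1 <= m \/ m <= - g%:Z - 1 ->
        exists2 c, c != 0 & leading (zminus D) (A m) (- m - g%:Z) c
    & forall f, KN_algebra f -> exists! c : int -> C,
        finite_set [set m | c m != 0] /\
        forall x, f x = \sum_(m \in [set: int]) c m * A m x].

Definition alpha_trivial : Prop := forall s, alpha D s = 0.

(* A is only used when all the alpha s vanish *)
Definition lax_piece (A : int -> S -> C) (m : int) : set (S -> 'M[C]_N) :=
  [set L | lax_algebra L /\
    if `[< alpha_trivial >] then
      exists2 X, fin_algebra X & forall x, ~ marked x -> L x = A m x *: X
    else
      exists X Y, [/\ fin_algebra X, fin_algebra Y,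
        mx_leading (zplus D) L m X & mx_leading (zminus D) L (- m - g%:Z) Y]].

(* The marked points, and the alpha s, are in generic position. The genericity
   required is that the homogeneous subspaces form an almost-grading with
   pieces parametrised by the leading coefficient at P. *)
Definition generic_position (A : int -> S -> C) : Prop :=
  [/\ alpha_trivial -> KN_basis A,
      direct_decomposition lax_algebra (lax_piece A),
      forall X m, fin_algebra X ->
        exists! L, lax_piece A m L /\ mx_leading (zplus D) L m X
    & almost_graded_bracket lax_bracket (lax_piece A)].

End LaxOperators.
Arguments lax_data : clear implicits.
Arguments lax_bracket {C g n k D} L L' _ /.
Arguments fin_algebra {C g n k} D _.
Arguments marked {C g n k} D _.
Arguments lax_algebra {C g n k} D _.
Arguments KN_algebra {C g n k} D _.
Arguments KN_basis {C g n k} D A.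
Arguments alpha_trivial {C g n k} D.
Arguments lax_piece {C g n k} D A m _.
Arguments generic_position {C g n k} D A.

(* Main.v *)
From HB Require Import structures.
Require Import Defs.
From mathcomp Require Import all_boot all_order all_algebra.
From mathcomp Require Import finmap spectral.
From mathcomp Require Import all_classical all_reals all_analysis.
From mathcomp Require Import ring zify.

Set Implicit Arguments.
Unset Strict Implicit.
Unset Printing Implicit Defensive.

Import Order.TTheory GRing.Theory Num.Theory.
Import numFieldNormedType.Exports.

Local Open Scope ring_scope.

(** Write [X_m] for the homogeneous element of degree [m] with leading
    coefficient [X] at the point [P_+], where [X] ranges over the simple matrix
    algebra [g].  The product of two leading terms is a leading term, so
    [[X_m, Y_k] = [X, Y]_(m+k)] up to components of higher degree, and to top
    order the Lax operator algebra is the loop algebra of [g].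

    Let a cocycle [ga] vanish on all pairs [(X_n, Y_m)] with [n + m > l]; a local
    cocycle does so for some [l].  The corrections of higher degree in the
    brackets are then invisible at level [n + m = l], so that
    [om n X Y := ga (X_n, Y_(l-n))] is a homogeneous cocycle of degree [l] on the
    loop algebra.  Such cocycles are computed in [loop_cocycleE]:
    [om n X Y = phi [X, Y] + a n tr (X Y)], with [a = 0] unless [l = 0].

    - For [n = 0] the cocycle identity says that [om 0] is a derivation of [g]
      with values in the dual of [g].  Averaging against the Casimir tensor shows
      that it is inner, which gives [phi].  This takes a Casimir operator that is
      a nonzero scalar: for the trace form it acts on [g] by [2N], [N - 2] and
      [N + 2] for sl, so and sp acting on vectors of length [N]
      ([classical_casimir]).
    - Once [phi] is subtracted, every [om n] is an invariant bilinear form, hence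
      [lambda n tr (X Y)] by Schur's lemma ([invariant_form_trace]).  The cocycle
      identity makes [lambda] additive in [n], and antisymmetry gives
      [l lambda 1 = 0].

    Hence every level [l <> 0] is killed by subtracting the coboundary of [phi]
    composed with the component of degree [l], and level [0] leaves a single
    number [a].  Finitely many steps make a local cocycle bounded from above by
    zero ([local_reduction]).  If moreover [a = 0], the descent goes on through
    all negative levels; the infinitely many correcting forms add up to one
    linear form, since an element of the algebra has only finitely many
    components, and the cocycle is a coboundary ([negative_coboundary]).  So the
    class of a local cocycle is determined by [a], and the theorem is linear
    algebra in dimension at most one.

    The rest shows that Lax operators fit this pattern: the algebra and its
    homogeneous pieces are linear subspaces, leading coefficients are unique and
    multiplicative, and the leading coefficients of the components of an
    operator are linear coordinates on the algebra ([lax_frame]). *)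

(** * Lie brackets and bilinear forms *)

Section LieBracket.
Context {C : numClosedFieldType} {N : nat}.
Implicit Types X Y Z : 'M[C]_N.

Lemma lie_bracketC X Y : lie_bracket X Y = - lie_bracket Y X.
Proof. by rewrite /lie_bracket opprB. Qed.

Lemma lie_bracketxx X : lie_bracket X X = 0.
Proof. by rewrite /lie_bracket subrr. Qed.

Lemma lie_bracket_linearl a X Y Z :
  lie_bracket (a *: X + Y) Z = a *: lie_bracket X Z + lie_bracket Y Z.
Proof.
rewrite /lie_bracket mulmxDl mulmxDr -scalemxAl -scalemxAr scalerBr opprD.
by rewrite !addrA; congr (_ - _); rewrite addrAC.
Qed.

Lemma lie_bracket_linearr a X Y Z :
  lie_bracket Z (a *: X + Y) = a *: lie_bracket Z X + lie_bracket Z Y.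
Proof.
by rewrite lie_bracketC lie_bracket_linearl opprD -scalerN -!(lie_bracketC Z).
Qed.

Lemma lie_bracket0r X : lie_bracket X 0 = 0.
Proof. by rewrite /lie_bracket mulmx0 mul0mx subrr. Qed.

Lemma lie_bracketZr a X Y : lie_bracket X (a *: Y) = a *: lie_bracket X Y.
Proof.
by rewrite -[a *: Y]addr0 lie_bracket_linearr lie_bracket0r addr0.
Qed.

Lemma lie_bracketNr X Y : lie_bracket X (- Y) = - lie_bracket X Y.
Proof. by rewrite -scaleN1r lie_bracketZr scaleN1r. Qed.

Lemma lie_derivation X Y Z :
  lie_bracket X (lie_bracket Y Z) =
  lie_bracket (lie_bracket X Y) Z + lie_bracket Y (lie_bracket X Z).
Proof.
rewrite /lie_bracket !mulmxBl !mulmxBr !mulmxA.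
move: (X *m Y *m Z) (X *m Z *m Y) (Y *m X *m Z) (Y *m Z *m X) (Z *m X *m Y)
  (Z *m Y *m X) => a1 a2 a3 a4 a5 a6.
by apply/matrixP => i j; rewrite !mxE; ring.
Qed.

Lemma lie_jacobi X Y Z :
  lie_bracket (lie_bracket X Y) Z + lie_bracket (lie_bracket Y Z) X
  + lie_bracket (lie_bracket Z X) Y = 0.
Proof.
rewrite (lie_bracketC (lie_bracket Y Z) X) lie_derivation.
rewrite (lie_bracketC Z X) (lie_bracketC (- _) Y) lie_bracketNr opprK.
by rewrite opprD addNKr addNr.
Qed.

Lemma trace_lie_bracket X Y Z :
  \tr (lie_bracket X Y *m Z) = \tr (X *m lie_bracket Y Z).
Proof.
rewrite /lie_bracket mulmxBl mulmxBr !raddfB /= !mulmxA.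
by rewrite -(mulmxA Y) [\tr (Y *m _)]mxtrace_mulC.
Qed.

End LieBracket.

Definition bilinear_form {C : fieldType} {V : lmodType C} (B : V -> V -> C) :=
  (forall a X Y Z, B (a *: X + Y) Z = a * B X Z + B Y Z) /\
  (forall a X Y Z, B Z (a *: X + Y) = a * B Z X + B Z Y).

Section BilinearForms.
Context {C : fieldType} {V : lmodType C} (B : V -> V -> C).
Hypothesis Bbil : bilinear_form B.

Lemma bilinear0l Y : B 0 Y = 0.
Proof. by case: Bbil => /(_ (-1) 0 0 Y); rewrite scaler0 addr0 mulN1r addNr. Qed.

Lemma bilinear0r Y : B Y 0 = 0.
Proof. by case: Bbil => _ /(_ (-1) 0 0 Y); rewrite scaler0 addr0 mulN1r addNr. Qed.

Lemma bilinearZl a X Y : B (a *: X) Y = a * B X Y.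
Proof. by case: Bbil => /(_ a X 0 Y); rewrite addr0 bilinear0l addr0. Qed.

Lemma bilinearZr a X Y : B Y (a *: X) = a * B Y X.
Proof. by case: Bbil => _ /(_ a X 0 Y); rewrite addr0 bilinear0r addr0. Qed.

Lemma bilinearDl X Z Y : B (X + Z) Y = B X Y + B Z Y.
Proof. by case: Bbil => /(_ 1 X Z Y); rewrite scale1r mul1r. Qed.

Lemma bilinearDr X Z Y : B Y (X + Z) = B Y X + B Y Z.
Proof. by case: Bbil => _ /(_ 1 X Z Y); rewrite scale1r mul1r. Qed.

Lemma bilinearNr X Y : B Y (- X) = - B Y X.
Proof. by rewrite -scaleN1r bilinearZr mulN1r. Qed.

Lemma bilinear_suml (I : finType) (X : I -> V) Y :
  B (\sum_i X i) Y = \sum_i B (X i) Y.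
Proof.
by apply: (big_morph (B^~ Y)) => [? ?|]; rewrite (bilinearDl, bilinear0l).
Qed.

Lemma bilinear_sumr (I : finType) (X : I -> V) Y :
  B Y (\sum_i X i) = \sum_i B Y (X i).
Proof.
by apply: (big_morph (B Y)) => [? ?|]; rewrite (bilinearDr, bilinear0r).
Qed.
End BilinearForms.

Section CasimirProjection.
Context {C : numClosedFieldType} {N : nat}.

Definition unit_mx (p : 'I_N * 'I_N) : 'M[C]_N := delta_mx p.1 p.2.
Definition swap_mx (p : 'I_N * 'I_N) : 'M[C]_N := delta_mx p.2 p.1.

(** The orthogonal projection onto [g] for the trace form.  It makes the dual bases
    of [g] superfluous: the images of the matrix units [E_ij] and [E_ji], indexed
    by the pairs [(i, j)], form dual systems of generators of [g]
    ([expand_unit], [expand_swap]), and the last field says that the Casimir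
    operator built from them acts on [g] by a nonzero scalar. *)
Record casimir_projection (g : set 'M[C]_N) := CasimirProjection {
  proj :> {linear 'M[C]_N -> 'M[C]_N};
  proj_in : forall Z, g (proj Z);
  proj_id : forall X, g X -> proj X = X;
  proj_adj : forall X Y, \tr (proj X *m Y) = \tr (X *m proj Y);
  proj_lie : forall X Y, g X -> g Y -> g (lie_bracket X Y);
  casimir_value : C;
  casimir_value_neq0 : casimir_value != 0;
  casimirE : forall Y, g Y ->
    \sum_p lie_bracket (proj (unit_mx p)) (lie_bracket (proj (swap_mx p)) Y)
    = casimir_value *: Y }.

Lemma trace_mul_unit (X : 'M[C]_N) p : \tr (X *m unit_mx p) = X p.2 p.1.
Proof.
rewrite /mxtrace (bigD1 p.2) //= big1 => [|i ne]; rewrite !mxE.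
  rewrite addr0 (bigD1 p.1) //= big1 => [|j ne]; rewrite !mxE ?eqxx ?mulr1 ?addr0 //.
  by rewrite (negPf ne) mulr0.
by apply: big1 => j _; rewrite !mxE (negPf ne) andbF mulr0.
Qed.

Lemma trace_mul_swap (X : 'M[C]_N) p : \tr (X *m swap_mx p) = X p.1 p.2.
Proof. exact: (trace_mul_unit X (p.2, p.1)). Qed.

Context {g : set 'M[C]_N} (pi : casimir_projection g).
Implicit Types X Y Z : 'M[C]_N.

Lemma proj_closed a X Y : g X -> g Y -> g (a *: X + Y).
Proof.
move=> gX gY; rewrite -(proj_id pi gX) -(proj_id pi gY) -linearP.
exact: proj_in.
Qed.

(** The projection being self-adjoint, the trace of [X] against the image of [E_ji]
    is the entry [X_ij]; the expansion is the image of [X = sum X_ij E_ij]. *)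
Lemma expand_unit X : g X -> X = \sum_p \tr (X *m pi (swap_mx p)) *: pi (unit_mx p).
Proof.
move=> gX; rewrite -{1}(proj_id pi gX) {1}[X]matrix_sum_delta pair_bigA /=.
rewrite linear_sum; apply: eq_bigr => p _; rewrite linearZ /=; congr (_ *: _).
by rewrite -proj_adj (proj_id pi gX) trace_mul_swap.
Qed.

Lemma expand_swap X : g X -> X = \sum_p \tr (X *m pi (unit_mx p)) *: pi (swap_mx p).
Proof.
move=> gX; rewrite {1}(expand_unit gX) (reindex (fun p => (p.2, p.1))) //=.
by exists (fun p => (p.2, p.1)) => -[].
Qed.

Lemma trace_form_nondegenerate X :
  g X -> (forall Y, g Y -> \tr (X *m Y) = 0) -> X = 0.
Proof.
move=> gX X0; rewrite (expand_unit gX) big1 // => p _.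
by rewrite X0 ?scale0r //; apply: proj_in.
Qed.

(** Invariance of the Casimir tensor under [ad X]: expand [ [X, e_p] ] and
    [ [X, f_p] ] in the dual systems and compare coefficients through the
    invariance of the trace form. *)
Lemma casimir_invariant (B : 'M[C]_N -> 'M[C]_N -> C) X :
  bilinear_form B -> g X ->
  \sum_p B (lie_bracket X (pi (unit_mx p))) (pi (swap_mx p)) =
  - \sum_p B (pi (unit_mx p)) (lie_bracket X (pi (swap_mx p))).
Proof.
move=> Bb gX.
have gb p Y : g Y -> g (lie_bracket X Y) by move=> ?; apply: (proj_lie pi).
under eq_bigr => p _.
  rewrite [lie_bracket _ _]expand_unit ?(bilinear_suml Bb); last first.
    by apply: (proj_lie pi) => //; apply: proj_in.
  over.
rewrite exchange_big /= -sumrN; apply: eq_bigr => q _.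
rewrite [lie_bracket X _]expand_swap ?(bilinear_sumr Bb) -?sumrN; last first.
  by apply: (proj_lie pi) => //; apply: proj_in.
apply: eq_bigr => p _; rewrite (bilinearZl Bb) (bilinearZr Bb) -mulNr.
congr (_ * _); rewrite lie_bracketC mulNmx raddfN /= trace_lie_bracket.
by rewrite mxtrace_mulC.
Qed.
End CasimirProjection.

(** * Casimir projections of the classical Lie algebras *)

Section ClassicalProjections.
Context {C : numClosedFieldType} {N : nat}.
Implicit Types X Y Z : 'M[C]_N.

Lemma delta_sandwich Z (a b c d : 'I_N) :
  delta_mx a b *m Z *m delta_mx c d = Z b c *: delta_mx a d.
Proof.
rewrite -(mul_delta_mx (0 : 'I_1) a b) -(mul_delta_mx (0 : 'I_1) c d) !mulmxA.
rewrite -(mulmxA (delta_mx a 0)) -rowE -(mulmxA (delta_mx a 0)) -colE.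
rewrite [col _ _]mx11_scalar !mxE mul_mx_scalar -scalemxAl.
by rewrite mul_delta_mx.
Qed.

(** Contractions of the matrix units around a matrix: [E_ij Z E_ji] adds up to the
    trace of [Z], and [E_ij Z E_ij] to its transpose.  All the Casimir operators
    below are evaluated from these two sums. *)
Lemma sum_unit_swap Z :
  \sum_p unit_mx p *m Z *m swap_mx p = (\tr Z)%:M.
Proof.
under eq_bigr => p _ do rewrite delta_sandwich.
rewrite -(pair_bigA _ (fun i j => Z j j *: delta_mx i i)) /=.
rewrite scalar_mx_sum_delta; apply: eq_bigr => i _.
by rewrite -scaler_suml.
Qed.

Lemma sum_unit_unit Z : \sum_p unit_mx p *m Z *m unit_mx p = Z^T.
Proof.
under eq_bigr => p _ do rewrite delta_sandwich.
rewrite [RHS]matrix_sum_delta pair_bigA; apply: eq_bigr => p _.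
by rewrite mxE.
Qed.

Lemma sum_pair_swap (V : nmodType) (F : 'I_N -> 'I_N -> V) :
  \sum_p F p.1 p.2 = \sum_p F p.2 p.1.
Proof.
rewrite (reindex (fun p => (p.2, p.1))) //=.
by exists (fun p => (p.2, p.1)) => -[].
Qed.

Lemma sum_swap_unit Z :
  \sum_p swap_mx p *m Z *m unit_mx p = (\tr Z)%:M.
Proof.
rewrite -sum_unit_swap.
by rewrite (sum_pair_swap (fun i j => delta_mx j i *m Z *m delta_mx i j)).
Qed.

Lemma sum_swap_swap Z : \sum_p swap_mx p *m Z *m swap_mx p = Z^T.
Proof.
rewrite -sum_unit_unit.
by rewrite (sum_pair_swap (fun i j => delta_mx j i *m Z *m delta_mx j i)).
Qed.

Lemma sandwich1 (I : finType) (e f : I -> 'M[C]_N) :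
  \sum_p e p *m 1%:M *m f p = \sum_p e p *m f p.
Proof. by apply: eq_bigr => p _; rewrite mulmx1. Qed.

(** [ [e, [f, Y]] = e f Y - e Y f - f Y e + Y f e ]. *)
Lemma casimir_from_sums (I : finType) (e f : I -> 'M[C]_N) a b Y :
  \sum_p e p *m f p = a%:M -> \sum_p f p *m e p = a%:M ->
  \sum_p e p *m Y *m f p = b *: Y -> \sum_p f p *m Y *m e p = b *: Y ->
  \sum_p lie_bracket (e p) (lie_bracket (f p) Y) = (2 * (a - b)) *: Y.
Proof.
move=> ef fe eYf fYe.
transitivity (\sum_p (e p *m f p *m Y - e p *m Y *m f p - f p *m Y *m e p
                      + Y *m (f p *m e p))).
  apply: eq_bigr => p _; rewrite /lie_bracket mulmxBr mulmxBl !mulmxA.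
  by rewrite opprB addrA addrAC.
rewrite big_split /= !sumrB -mulmx_suml -mulmx_sumr ef fe eYf fYe.
rewrite mul_scalar_mx mul_mx_scalar -!scalerBl -scalerDl; congr (_ *: _).
by ring.
Qed.

Lemma lie_bracket_scalarl a X : lie_bracket a%:M X = 0.
Proof. by rewrite /lie_bracket mul_scalar_mx mul_mx_scalar subrr. Qed.

Definition traceless_part Z : 'M[C]_N := Z - (\tr Z / N%:R)%:M.

Fact traceless_part_is_linear : linear traceless_part.
Proof.
move=> a X Y; rewrite /traceless_part linearP /= mulrDl raddfD /= -mulrA
  -scale_scalar_mx.
by rewrite scalerBr opprD !addrA; congr (_ - _); rewrite addrAC.
Qed.
HB.instance Definition _ :=
  GRing.isLinear.Build C 'M[C]_N 'M[C]_N *:%R traceless_part traceless_part_is_linear.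

Lemma lie_bracket_traceless_part X Y : lie_bracket (traceless_part X) Y = lie_bracket
  X Y.
Proof.
rewrite /traceless_part addrC -scaleN1r scale_scalar_mx -[X in _ + X]scale1r addrC.
by rewrite lie_bracket_linearl lie_bracket_scalarl addr0 scale1r.
Qed.

Lemma lie_bracket_trace0 X Y : \tr (lie_bracket X Y) = 0.
Proof. by rewrite /lie_bracket raddfB /= mxtrace_mulC subrr. Qed.

(** Brackets do not see the scalar part removed by the projection, so the Casimir
    operator is that of all matrices, which is [2N] on traceless ones. *)
Lemma sl_casimir sigma :
  (N > 0)%N -> casimir_projection (classical SL sigma : set 'M[C]_N).
Proof.
move=> N0; have N0C : N%:R != 0 :> C by rewrite pnatr_eq0 -lt0n.
apply: (@CasimirProjection _ _ _ traceless_part) (2 * (N%:R - 0)) _ _ => /=.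
- by move=> Z; rewrite /traceless_part raddfB /= mxtrace_scalar -[X in _ -
    X]mulr_natr divfK ?subrr.
- by move=> X X0; rewrite /traceless_part X0 mul0r raddf0 subr0.
- move=> X Y; rewrite /traceless_part mulmxBl mulmxBr !raddfB /= mul_scalar_mx.
  by rewrite mul_mx_scalar !mxtraceZ; ring.
- by move=> X Y _ _; apply: lie_bracket_trace0.
- by rewrite subr0 mulf_neq0 // pnatr_eq0.
move=> Y Y0; under eq_bigr => p _ do rewrite !lie_bracket_traceless_part.
apply: casimir_from_sums.
- by rewrite -sandwich1 sum_unit_swap mxtrace1.
- by rewrite -sandwich1 sum_swap_unit mxtrace1.
- by rewrite sum_unit_swap Y0 scale0r raddf0.
- by rewrite sum_swap_unit Y0 scale0r raddf0.
Qed.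

(** Both so and sp consist of the skew elements for the involution
    [Z |-> s^-1 Z^T s], with [s = 1], [eps = 1] for so and [s = sigma], [eps = -1] for
    sp; the two cases are treated together. *)
Variables (s : 'M[C]_N) (eps : C).
Hypotheses (s_unit : s \in unitmx) (s_sym : s^T = eps *: s) (eps2 : eps * eps = 1).

Definition adjoint Z : 'M[C]_N := invmx s *m Z^T *m s.
Definition skew_part Z : 'M[C]_N := 2^-1 *: (Z - adjoint Z).

Fact skew_part_is_linear : linear skew_part.
Proof.
move=> a X Y; rewrite /skew_part /adjoint linearP /= mulmxDr mulmxDl.
rewrite -scalemxAr -scalemxAl opprD addrACA -scalerBr scalerDr !scalerA.
by rewrite [a * _]mulrC.
Qed.
HB.instance Definition _ :=
  GRing.isLinear.Build C 'M[C]_N 'M[C]_N *:%R skew_part skew_part_is_linear.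

Lemma invmx_sym : (invmx s)^T = eps *: invmx s.
Proof.
rewrite trmx_inv s_sym.
have eu : eps \is a GRing.unit by apply/unitrPr; exists eps.
by rewrite invmxZ ?unitmxZ // -[eps^-1]mulr1 -eps2 mulKr.
Qed.

Lemma adjointK Z : adjoint (adjoint Z) = Z.
Proof.
rewrite /adjoint !trmx_mul trmxK s_sym invmx_sym -!scalemxAl -!scalemxAr.
by rewrite scalerA eps2 scale1r !mulmxA mulVmx // mul1mx mulmxKV.
Qed.

Lemma adjointM X Y : adjoint (X *m Y) = adjoint Y *m adjoint X.
Proof. by rewrite /adjoint trmx_mul !mulmxA (mulmxK s_unit). Qed.

Lemma adjointB X Y : adjoint (X - Y) = adjoint X - adjoint Y.
Proof. by rewrite /adjoint raddfB /= mulmxBr mulmxBl. Qed.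

Lemma trace_adjoint Z : \tr (adjoint Z) = \tr Z.
Proof. by rewrite /adjoint mxtrace_mulC mulmxA mulmxV // mul1mx mxtrace_tr. Qed.

(** The involution turns [E_ji] into [s^-1 E_ij s], which reduces the mixed
    contractions to the transposing one; the sign [eps] comes from transposing
    [s] or its inverse. *)
Lemma sum_unit_adjoint_swap Z :
  \sum_p unit_mx p *m Z *m adjoint (swap_mx p) = eps *: adjoint Z.
Proof.
transitivity ((\sum_p unit_mx p *m (Z *m invmx s) *m unit_mx p) *m s).
  rewrite mulmx_suml; apply: eq_bigr => p _.
  by rewrite /adjoint trmx_delta !mulmxA.
by rewrite sum_unit_unit trmx_mul invmx_sym -!scalemxAl.
Qed.

Lemma sum_adjoint_unit_swap Z :
  \sum_p adjoint (unit_mx p) *m Z *m swap_mx p = eps *: adjoint Z.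
Proof.
transitivity (invmx s *m (\sum_p swap_mx p *m (s *m Z) *m swap_mx p)).
  rewrite mulmx_sumr; apply: eq_bigr => p _.
  by rewrite /adjoint trmx_delta !mulmxA.
by rewrite sum_swap_swap trmx_mul s_sym -!scalemxAr mulmxA.
Qed.

Lemma sum_swap_adjoint_unit Z :
  \sum_p swap_mx p *m Z *m adjoint (unit_mx p) = eps *: adjoint Z.
Proof.
rewrite -sum_unit_adjoint_swap.
by rewrite (sum_pair_swap (fun i j => delta_mx j i *m Z *m adjoint (delta_mx i j))).
Qed.

Lemma sum_adjoint_swap_unit Z :
  \sum_p adjoint (swap_mx p) *m Z *m unit_mx p = eps *: adjoint Z.
Proof.
rewrite -sum_adjoint_unit_swap.
by rewrite (sum_pair_swap (fun i j => adjoint (delta_mx j i) *m Z *m delta_mx i j)).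
Qed.

Lemma adjoint_sum (I : finType) (F : I -> 'M[C]_N) :
  adjoint (\sum_i F i) = \sum_i adjoint (F i).
Proof. by rewrite /adjoint raddf_sum /= mulmx_sumr mulmx_suml. Qed.

Lemma adjointZ a X : adjoint (a *: X) = a *: adjoint X.
Proof. by rewrite /adjoint linearZ /= -scalemxAr -scalemxAl. Qed.

(** Among the four products of [e - e*] and [f - f*], the two mixed ones contribute
    [- eps Z*] each and the two others [tr Z] each. *)
Lemma sum_skew (e f : 'I_N * 'I_N -> 'M[C]_N) Z :
  (forall Y, \sum_p e p *m Y *m f p = (\tr Y)%:M) ->
  (forall Y, \sum_p f p *m Y *m e p = (\tr Y)%:M) ->
  (forall Y, \sum_p e p *m Y *m adjoint (f p) = eps *: adjoint Y) ->
  (forall Y, \sum_p adjoint (e p) *m Y *m f p = eps *: adjoint Y) ->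
  \sum_p skew_part (e p) *m Z *m skew_part (f p) =
  2^-1 *: ((\tr Z)%:M - eps *: adjoint Z).
Proof.
move=> ef fe eaf fae.
transitivity (\sum_p 4^-1 *: (e p *m Z *m f p - e p *m Z *m adjoint (f p)
  - adjoint (e p) *m Z *m f p +
   adjoint (f p *m adjoint Z *m e p))).
  apply: eq_bigr => p _; rewrite /skew_part -!scalemxAl -!scalemxAr scalerA.
  congr (_ *: _); first by rewrite -invfM -natrM.
  rewrite (adjointM (f p *m _)) (adjointM (f p)) mulmxA !adjointK !mulmxBl !mulmxBr
    !mulmxA opprB addrA.
  by rewrite addrAC.
rewrite -scaler_sumr big_split /= !sumrB -!adjoint_sum ef eaf fae fe trace_adjoint.
have -> : adjoint (\tr Z)%:M = (\tr Z)%:M.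
  by rewrite /adjoint tr_scalar_mx mul_mx_scalar -scalemxAl mulVmx // scalemx1.
move: (_%:M) (eps *: _) => T U; apply/matrixP => i j; rewrite !mxE.
by field.
Qed.

(** By [sum_skew] the products [e f] add up to [(N - eps) / 2], and the products
    [e Y f] to [eps / 2] times [Y] for a skew [Y]; so the Casimir scalar is
    [N - 2 eps]. *)
Lemma skew_casimir (g : set 'M[C]_N) :
  (forall X, g X <-> adjoint X = - X) -> N%:R != 2 * eps ->
  casimir_projection g.
Proof.
move=> gP Nne.
have a := sum_skew _ sum_unit_swap sum_swap_unit
   sum_unit_adjoint_swap sum_adjoint_unit_swap.
have b := sum_skew _ sum_swap_unit sum_unit_swap
   sum_swap_adjoint_unit sum_adjoint_swap_unit.
apply: (@CasimirProjection _ _ _ skew_part)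
  (2 * (2^-1 * (N%:R - eps) - 2^-1 * eps)) _ _ => /=.
- move=> Z; apply/gP; rewrite /skew_part adjointZ adjointB adjointK.
  by rewrite -scalerN opprB.
- move=> X /gP aX; rewrite /skew_part aX opprK -mulr2n -[X *+ 2]scaler_nat scalerA.
  by rewrite mulVf ?scale1r // pnatr_eq0.
- move=> X Y; rewrite /skew_part -scalemxAl -scalemxAr !mxtraceZ mulmxBl mulmxBr.
  by rewrite !raddfB /= -[\tr (X *m adjoint Y)]trace_adjoint (adjointM X) adjointK
    [\tr (Y *m _)]mxtrace_mulC.
- move=> X Y /gP aX /gP aY; apply/gP; rewrite /lie_bracket adjointB !adjointM.
  by rewrite aX aY !mulmxN !mulNmx !opprK opprB.
- have -> : 2 * (2^-1 * (N%:R - eps) - 2^-1 * eps) = N%:R - 2 * eps by field.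
  by rewrite subr_eq0.
move=> Y /gP aY.
have Y0 : \tr Y = 0.
  have : \tr Y + \tr Y = 0 by rewrite -{1}trace_adjoint aY raddfN addNr.
  by rewrite -mulr2n => /eqP; rewrite mulrn_eq0 /= => /eqP.
have one : adjoint 1%:M = 1%:M by rewrite /adjoint trmx1 mulmx1 mulVmx.
apply: casimir_from_sums.
- apply: etrans (esym (sandwich1 _ _)) _; by rewrite a one mxtrace1 scale_scalar_mx
    mulr1 -raddfB /= scale_scalar_mx.
- apply: etrans (esym (sandwich1 _ _)) _; by rewrite b one mxtrace1 scale_scalar_mx
    mulr1 -raddfB /= scale_scalar_mx.
- by rewrite a Y0 raddf0 sub0r aY !scalerN opprK scalerA.
- by rewrite b Y0 raddf0 sub0r aY !scalerN opprK scalerA.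
Qed.
End ClassicalProjections.

Section ClassicalCasimir.
Context {C : numClosedFieldType}.

Lemma so2_abelian (X Y : 'M[C]_2) :
  X^T = - X -> Y^T = - Y -> lie_bracket X Y = 0.
Proof.
have skew2 (Z : 'M[C]_2) : Z^T = - Z -> Z = Z 0 1 *: (delta_mx 0 1 - delta_mx 1 0).
  move=> /matrixP Zs; have diag i : Z i i = 0.
    have := Zs i i; rewrite !mxE => /eqP.
    by rewrite -addr_eq0 -mulr2n mulrn_eq0 /= => /eqP.
  have I2 (i : 'I_2) : i = 0 \/ i = 1.
    by case: i => [[|[|[]]] //= ilt]; [left | right]; apply: val_inj.
  have := Zs 0 1; rewrite !mxE => Z10; apply/matrixP => i j; rewrite !mxE.
  by case: (I2 i) (I2 j) => -> [] ->; rewrite /= ?diag ?Z10 ?subr0 ?sub0r ?subrr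
    ?mulr0 ?mulrN1 ?mulr1.
move=> /skew2 -> /skew2 ->.
by rewrite lie_bracketZr lie_bracketC lie_bracketZr lie_bracketxx !(scaler0, oppr0).
Qed.

(** The Casimir scalar vanishes only for so(2) and for matrices of size zero, which
    are excluded because they are abelian. *)
Lemma classical_casimir N k (sigma : 'M[C]_N) :
  (k = SP -> sigma^T = - sigma) -> (k = SP -> sigma \in unitmx) ->
  (exists X Y,
    [/\ classical k sigma X, classical k sigma Y & lie_bracket X Y != 0]) ->
  casimir_projection (classical k sigma).
Proof.
move=> skew nondeg nonab.
have N0 : (0 < N)%N.
  case: N sigma skew nondeg nonab => // ? _ _ [X [Y [_ _]]] /eqP[].
  by rewrite [LHS]flatmx0.
case: k skew nondeg nonab => skew nondeg nonab.
- exact: sl_casimir.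
- apply: (@skew_casimir _ _ 1%:M 1); rewrite ?unitmx1 ?trmx1 ?scale1r ?mulr1 //.
    by move=> X; rewrite /adjoint invmx1 mul1mx mulmx1.
  apply/eqP => /eqP; rewrite eqr_nat => /eqP N2; case: nonab => X [Y [gX gY]].
  by subst N; rewrite so2_abelian ?eqxx.
- apply: (@skew_casimir _ _ sigma (-1)).
  + exact: nondeg.
  + by rewrite scaleN1r skew.
  + by rewrite mulrNN mulr1.
  + move=> X; have u := nondeg erefl; rewrite /adjoint; split=> [|e].
      move/eqP; rewrite addr_eq0 => /eqP e.
      by rewrite -mulmxA e mulmxN mulKmx.
    by rewrite /=; move/(congr1 (mulmx sigma)): e;
      rewrite !mulmxA mulmxV // mul1mx => ->; rewrite mulmxN addNr.
  + by rewrite mulrN1 -addr_eq0 -natrD pnatr_eq0 addn2.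
Qed.
End ClassicalCasimir.

(** * Invariant forms on a simple Lie algebra *)

Section Schur.
Context {C : numClosedFieldType} {N : nat}.
Context {g : set 'M[C]_N} (pi : casimir_projection g).
Hypothesis g_simple : simple_lie_algebra g.
Implicit Types X Y Z : 'M[C]_N.

(** [W] is a basis of [g], seen as a space of row vectors, so the product
    [W *m lin_mx T *m pinvmx W] is the matrix of the restriction of [T] to [g]. *)
Lemma stable_eigenvector (T : {linear 'M[C]_N -> 'M[C]_N}) X0 :
  g X0 -> X0 != 0 -> (forall X, g X -> g (T X)) ->
  exists a X, [/\ g X, X != 0 & T X = a *: X].
Proof.
move=> gX0 X0n0 gT; pose W := row_base (lin_mx pi).
have gW u : g (vec_mx (u *m W)).
  have /submxP[v ->] : (u *m W <= lin_mx pi)%MS.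
    by rewrite (submx_trans (submxMl _ _)) // eq_row_base.
  by rewrite mx_rV_lin; apply: proj_in.
have Wg X : g X -> (mxvec X <= W)%MS.
  by move=> gX; rewrite eq_row_base -(proj_id pi gX) -mul_vec_lin submxMl.
have WT : (W *m lin_mx T <= W)%MS.
  apply/row_subP => i; rewrite row_mul rowE mul_rV_lin.
  by apply: Wg; apply: gT; apply: gW.
have r0 : (0 < \rank (lin_mx pi))%N.
  rewrite lt0n; apply: contra X0n0 => r0.
  have /submxP[D] := Wg _ gX0; have -> : W = 0.
    by apply/eqP; rewrite -mxrank_eq0 eq_row_base.
  by rewrite mulmx0 => /(canRL mxvecK) ->; rewrite raddf0.
have [|v vn0] := @common_eigenvector C _ [:: W *m lin_mx T *m pinvmx W] r0.
  by move=> A B; rewrite !inE => /eqP -> /eqP ->.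
rewrite /= andbT => /sub_rVP[a va].
exists a, (vec_mx (v *m W)); split; first exact: gW.
  apply: contra vn0 => /eqP /(canRL vec_mxK); rewrite raddf0 => vW.
  by apply/eqP/(row_free_inj (row_base_free (lin_mx pi))); rewrite mul0mx.
rewrite -mx_rV_lin -linearZ /=; congr (vec_mx _).
by rewrite scalemxAl -va -!(mulmxA v) mulmxKpV.
Qed.

(** Schur's lemma: represent the form as [B X Y = tr (T X Y)].  Invariance means that
    [T] commutes with all brackets, so that an eigenspace of [T] in [g] is a nonzero
    ideal, that is, all of [g]. *)
Lemma invariant_form_trace (B : 'M[C]_N -> 'M[C]_N -> C) :
  bilinear_form B ->
  (forall X Y Z, g X -> g Y -> g Z ->
     B (lie_bracket X Y) Z + B Y (lie_bracket X Z) = 0) ->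
  exists a, forall X Y, g X -> g Y -> B X Y = a * \tr (X *m Y).
Proof.
move=> Bb Binv.
pose T X := \sum_p B X (pi (swap_mx p)) *: pi (unit_mx p).
have Tlin : linear T.
  move=> a X Y; rewrite /T scaler_sumr -big_split /=; apply: eq_bigr => p _.
  by rewrite Bb.1 scalerDl scalerA.
have sum_in (I : finType) (a : I -> C) (F : I -> 'M[C]_N) : (forall i, g (F i)) -> g
  (\sum_i a i *: F i).
  move=> gF; have g0 : g 0 by rewrite -(raddf0 pi); apply: proj_in.
  apply: (big_ind g) => // [X Y gX gY|i _].
    by rewrite -[X]scale1r; apply: (proj_closed pi).
  by rewrite -[_ *: _]addr0; apply: (proj_closed pi).
have gT X : g (T X) by apply: sum_in => p; apply: proj_in.
have trT X Y : g Y -> \tr (T X *m Y) = B X Y.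
  move=> gY; rewrite [in RHS](expand_swap pi gY) (bilinear_sumr Bb).
  rewrite /T mulmx_suml raddf_sum /=; apply: eq_bigr => p _.
  by rewrite -scalemxAl mxtraceZ (bilinearZr Bb) mulrC mxtrace_mulC.
have Teq X Z : g X -> g Z -> T (lie_bracket Z X) = lie_bracket Z (T X).
  move=> gX gZ; apply/eqP; rewrite -subr_eq0; apply/eqP.
  have gD : g (T (lie_bracket Z X) - lie_bracket Z (T X)).
    rewrite addrC -scaleN1r; apply: (proj_closed pi) => //.
    exact: (proj_lie pi).
  apply: (trace_form_nondegenerate pi gD) => Y gY.
  rewrite mulmxBl raddfB /= trT // (lie_bracketC Z (T X)) mulNmx raddfN /= opprK.
  by rewrite trace_lie_bracket trT ?Binv //; apply: (proj_lie pi).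
have [[X0 [Y0 [gX0 gY0 n0]]] g_ideal] := g_simple.
pose TL := GRing.isLinear.Build C 'M[C]_N 'M[C]_N *:%R T Tlin.
pose Tl : {linear 'M[C]_N -> 'M[C]_N} := HB.pack T TL.
have [||a [X [gX Xn0 TX]]] := @stable_eigenvector Tl (lie_bracket X0 Y0) _ n0 _.
- exact: (proj_lie pi).
- by move=> X _; apply: gT.
exists a => Y Z gY gZ.
pose I := (limg (linfun pi) :&: lker (linfun Tl - a *: \1%VF))%VS.
have memI V : (V \in I) = `[< g V /\ T V = a *: V >].
  rewrite memv_cap memv_ker add_lfunE opp_lfunE scale_lfunE id_lfunE lfunE /=.
  rewrite subr_eq0 asbool_and; congr (_ && _); last by apply/eqP/asboolP.
  apply/memv_imgP/asboolP => [[U _ ->]|gV]; first by rewrite lfunE; apply: proj_in.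
  by exists V; rewrite ?memvf // lfunE /= (proj_id pi).
have [||I0|Iall] := g_ideal I.
- by move=> V; rewrite memI => /asboolP[].
- move=> U V gU; rewrite !memI => /asboolP[gV TV]; apply/asboolP.
  by split; [exact: (proj_lie pi)|rewrite Teq // TV lie_bracketZr].
- have : X \in I by rewrite memI; apply/asboolP.
  by rewrite I0 memv0 (negPf Xn0).
have := Iall Y gY; rewrite memI => /asboolP[_ TY].
by rewrite -trT // TY -scalemxAl mxtraceZ.
Qed.
End Schur.

(** * Homogeneous cocycles of the loop algebra *)

Section LoopCocycles.
Context {C : numClosedFieldType} {N : nat}.
Context {g : set 'M[C]_N} (pi : casimir_projection g).
Hypothesis g_simple : simple_lie_algebra g.
Implicit Types (X Y Z W : 'M[C]_N) (n m p l : int).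

(** [om n X Y] stands for the value of a cocycle of degree [l] at [X t^n] and
    [Y t^(l-n)]; the cocycle is zero on the other pairs of degrees. *)
Definition loop_cocycle l (om : int -> 'M[C]_N -> 'M[C]_N -> C) : Prop :=
  [/\ forall n, bilinear_form (om n),
      forall n X Y, g X -> g Y -> om n X Y = - om (l - n) Y X &
      forall n m p X Y Z, n + m + p = l -> g X -> g Y -> g Z ->
        om (n + m) (lie_bracket X Y) Z + om (m + p) (lie_bracket Y Z) X
        + om (p + n) (lie_bracket Z X) Y = 0].

(** If [b X] depends on [X] as a derivation into the dual of [g], this is the linear
    form of which it is the inner derivation: the average of [b] over the Casimir
    tensor. *)
Definition casimir_potential (b : 'M[C]_N -> 'M[C]_N -> C) W : C :=
  (casimir_value pi)^-1 *
  \sum_p b (pi (unit_mx p)) (lie_bracket (pi (swap_mx p)) W).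

Lemma casimir_potential_linear b a X Y : bilinear_form b ->
  casimir_potential b (a *: X + Y) =
  a * casimir_potential b X + casimir_potential b Y.
Proof.
move=> [_ br]; rewrite /casimir_potential mulrCA -mulrDr; congr (_ * _).
rewrite mulr_sumr -big_split /=; apply: eq_bigr => p _.
by rewrite lie_bracket_linearr br.
Qed.

(** Every derivation into the dual of [g] is inner.  Moving [X] across the two
    factors of the Casimir tensor trades the terms of the potential at [ [X, W] ] for
    [b X (Casimir W)], by the derivation property. *)
Lemma derivation_potential b X W :
  bilinear_form b ->
  (forall X Y Z, g X -> g Y -> g Z ->
    b (lie_bracket X Y) Z = b X (lie_bracket Y Z) - b Y (lie_bracket X Z)) ->
  g X -> g W -> b X W = casimir_potential b (lie_bracket X W).
Proof.
move=> bb bder gX gW.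
have gl Y Z : g Y -> g Z -> g (lie_bracket Y Z) by apply: (proj_lie pi).
have gp Z : g (pi Z) by apply: proj_in.
apply: (mulfI (casimir_value_neq0 pi)).
rewrite /casimir_potential mulrA divff ?casimir_value_neq0 // mul1r.
rewrite -(bilinearZr bb) -(casimirE pi gW) (bilinear_sumr bb).
have bW : bilinear_form (fun P Q => b P (lie_bracket Q W)).
  split=> a Y Z T; first by rewrite bb.1.
  by rewrite lie_bracket_linearl bb.2.
have := casimir_invariant pi bW gX; rewrite -sumrN => inv.
under [RHS]eq_bigr => p _.
  rewrite lie_derivation (lie_bracketC (pi _) X) (bilinearDr bb).
  rewrite (lie_bracketC (- _) W) lie_bracketNr opprK (lie_bracketC W) (bilinearNr bb).
  over.
rewrite big_split /= -inv -big_split /=; apply: eq_bigr => p _.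
by rewrite bder ?subrK //; apply: gl.
Qed.

Lemma additive_int (lam : int -> C) :
  {morph lam : n m / n + m} -> forall n, lam n = n%:~R * lam 1.
Proof.
move=> lamD.
have lam0 : lam 0 = 0 by apply: (addrI (lam 0)); rewrite -lamD !addr0.
have lamN n : lam (- n) = - lam n.
  by apply/eqP; rewrite -addr_eq0 -lamD addNr lam0.
have lamn (n : nat) : lam n%:Z = n%:R * lam 1.
  elim: n => [|n IHn]; first by rewrite lam0 mul0r.
  by rewrite intS lamD IHn -natr1 mulrDl mul1r addrC.
case=> n; first by rewrite lamn.
by rewrite NegzE lamN lamn mulrNz mulNr.
Qed.

Lemma trace_bracket_neq0 : exists X Y Z,
  [/\ g X, g Y, g Z & \tr (lie_bracket X Y *m Z) != 0].
Proof.
have [[X [Y [gX gY XYn0]]] _] := g_simple.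
apply: contrapT => nex; case/eqP: XYn0.
apply: (trace_form_nondegenerate pi); first exact: (proj_lie pi).
move=> Z gZ; apply/eqP; apply: contrapT => trn0; apply: nex.
by exists X, Y, Z; split=> //; apply/negP.
Qed.

(** The homogeneous cocycles of the loop algebra: a coboundary, plus in degree [0]
    a multiple of the residue cocycle [n tr (X Y)]. *)
Lemma loop_cocycleE l om : loop_cocycle l om ->
  exists2 a, l != 0 -> a = 0 &
    forall n X Y, g X -> g Y ->
      om n X Y = casimir_potential (om 0) (lie_bracket X Y)
                 + a * n%:~R * \tr (X *m Y).
Proof.
move=> [omb oma omc]; set phi := casimir_potential (om 0).
have gl Y Z : g Y -> g Z -> g (lie_bracket Y Z) by apply: (proj_lie pi).
(* with two arguments in degree 0, the cocycle identity is the derivation property *)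
have om0 X W : g X -> g W -> om 0 X W = phi (lie_bracket X W).
  apply: (derivation_potential (omb 0)) => {X W} X Y Z gX gY gZ.
  have [gYZ gXZ gZX] := And3 (gl _ _ gY gZ) (gl _ _ gX gZ) (gl _ _ gZ gX).
  have := omc 0 0 l X Y Z; rewrite !addr0 !add0r => /(_ erefl gX gY gZ)/eqP.
  rewrite (oma l _ X) // (oma l _ Y) // subrr.
  rewrite (lie_bracketC Z X) (bilinearNr (omb 0)) opprK -addrA addr_eq0 => /eqP ->.
  by rewrite opprD opprK.
have phiD a X Y : phi (a *: X + Y) = a * phi X + phi Y.
  exact: casimir_potential_linear.
have phi0 : phi 0 = 0 by have := phiD (-1) 0 0; rewrite scaler0 addr0 mulN1r addNr.
have phiN X : phi (- X) = - phi X.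
  by have := phiD (-1) X 0; rewrite addr0 scaleN1r mulN1r phi0 addr0.
pose om' n X Y := om n X Y - phi (lie_bracket X Y).
have omb' n : bilinear_form (om' n).
  split=> a X Y Z; rewrite /om' ?lie_bracket_linearl ?lie_bracket_linearr phiD;
    by rewrite ?(omb n).1 ?(omb n).2 mulrBr opprD addrACA.
have oma' n X Y : g X -> g Y -> om' n X Y = - om' (l - n) Y X.
  by move=> gX gY; rewrite /om' oma // opprB lie_bracketC phiN opprK addrC.
have omc' n m p X Y Z : n + m + p = l -> g X -> g Y -> g Z ->
        om' (n + m) (lie_bracket X Y) Z + om' (m + p) (lie_bracket Y Z) X
        + om' (p + n) (lie_bracket Z X) Y = 0.
  move=> nmp gX gY gZ; rewrite /om'.
  have regroup (x y z p1 p2 p3 : C) :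
    (x - p1) + (y - p2) + (z - p3) = (x + y + z) - (p1 + p2 + p3) by ring.
  rewrite regroup omc // sub0r.
  have phiS U T : phi U + phi T = phi (U + T).
    by have := phiD 1 U T; rewrite scale1r mul1r => ->.
  by rewrite !phiS lie_jacobi phi0 oppr0.
have om0' X Y : g X -> g Y -> om' 0 X Y = 0.
  by move=> gX gY; rewrite /om' om0 // subrr.
(* as om' 0 vanishes, the identity with one argument in degree 0 is invariance *)
have inv m X Y Z : g X -> g Y -> g Z ->
    om' m (lie_bracket X Y) Z + om' m Y (lie_bracket X Z) = 0.
  move=> gX gY gZ.
  have [gYZ gXZ gZX] := And3 (gl _ _ gY gZ) (gl _ _ gX gZ) (gl _ _ gZ gX).
  have := omc' 0 m (l - m) X Y Z.
  rewrite add0r addr0 addrC subrK => /(_ erefl gX gY gZ).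
  rewrite (oma' l _ X) // (oma' (l - m) _ Y) // subrr om0' // oppr0 addr0.
  have -> : l - (l - m) = m by ring.
  by rewrite (lie_bracketC Z X) (bilinearNr (omb' m)) opprK.
have /choice[lam lamP] n := invariant_form_trace pi g_simple (omb' n) (inv n).
have [X0 [Y0 [Z0 [gX0 gY0 gZ0 tn0]]]] := trace_bracket_neq0.
set t := \tr _ in tn0.
have [gXY gYZ gZX] := And3 (gl _ _ gX0 gY0) (gl _ _ gY0 gZ0) (gl _ _ gZ0 gX0).
have tY : \tr (lie_bracket Y0 Z0 *m X0) = t by rewrite mxtrace_mulC
  -trace_lie_bracket.
have tZ : \tr (lie_bracket Z0 X0 *m Y0) = t by rewrite trace_lie_bracket mxtrace_mulC.
have lama n : lam n = - lam (l - n).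
  apply: (mulIf tn0); rewrite mulNr -lamP // oma' // lamP //.
  by rewrite mxtrace_mulC.
have lamc n m p : n + m + p = l -> lam (n + m) + lam (m + p) + lam (p + n) = 0.
  move=> nmp; apply: (mulIf tn0); rewrite mul0r !mulrDl -{2}tY -{2}tZ.
  by rewrite -!lamP // omc'.
have lam0 : lam 0 = 0.
  by apply: (mulIf tn0); rewrite -lamP // om0' // mul0r.
(* lam l = 0 as lam 0 = 0, and lam (n + m) = - lam (l - (n + m)) is lam n + lam m *)
have lamD : {morph lam : n m / n + m}.
  move=> n m; have := lamc n m (l - (n + m)).
  rewrite addrC subrK => /(_ erefl) /eqP.
  have -> : m + (l - (n + m)) = l - n by ring.
  have -> : l - (n + m) + n = l - m by ring.
  rewrite -addrA addr_eq0 => /eqP ->.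
  by rewrite opprD -!lama.
have lamE := additive_int lamD.
exists (lam 1) => [ln0|n X Y gX gY].
  have : lam l = 0 by rewrite lama subrr lam0 oppr0.
  by rewrite lamE => /eqP; rewrite mulf_eq0 intr_eq0 (negPf ln0) => /eqP.
by rewrite [lam 1 * _]mulrC -lamE -lamP // /om' addrC subrK.
Qed.
End LoopCocycles.
Arguments loop_cocycle {C N} g l om.

(** * Level by level reduction *)

Section Cohomology.
Context {C : fieldType} {V : lmodType C} (br : V -> V -> V) (G : set V).
Implicit Types (ga : V -> V -> C) (a b : C).
Local Notation coh := (cohomologous br G).

Lemma cohomologous_refl ga : coh ga ga.
Proof.
by exists (fun=> 0) => [a L L' _ _|L L' _ _]; rewrite ?mulr0 ?addr0 ?subrr.
Qed.

Lemma cohomologous_comb a b ga1 ga2 de1 de2 : coh ga1 de1 -> coh ga2 de2 ->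
  coh (fun L L' => a * ga1 L L' + b * ga2 L L')
      (fun L L' => a * de1 L L' + b * de2 L L').
Proof.
move=> [p1 l1 e1] [p2 l2 e2]; exists (fun L => a * p1 L + b * p2 L).
  by move=> c L L' GL GL'; rewrite l1 // l2 //; ring.
by move=> L L' GL GL'; rewrite -e1 // -e2 //; ring.
Qed.

Lemma cohomologous_eq ga1 ga2 de1 de2 :
  (forall L L', G L -> G L' -> ga1 L L' - de1 L L' = ga2 L L' - de2 L L') ->
  coh ga1 de1 -> coh ga2 de2.
Proof.
by move=> e [p l1 e1]; exists p => // L L' GL GL'; rewrite -e // e1.
Qed.

Lemma cohomologous_sym ga de : coh ga de -> coh de ga.
Proof.
move=> h; apply: cohomologous_eq (cohomologous_comb (-1) 0 h (cohomologous_refl ga)).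
by move=> L L' _ _; ring.
Qed.

Lemma cohomologous_trans de ga th : coh ga de -> coh de th -> coh ga th.
Proof.
move=> h1 h2; apply: cohomologous_eq (cohomologous_comb 1 1 h1 h2).
by move=> L L' _ _; ring.
Qed.

Lemma cohomologous_scale a ga de : coh ga de -> coh (scale_form a ga) (scale_form a
  de).
Proof.
move=> h; apply: cohomologous_eq (cohomologous_comb a 0 h (cohomologous_refl ga)).
by move=> L L' _ _; rewrite /scale_form; ring.
Qed.

Lemma cohomologous_scale0 a : coh (scale_form a (fun _ _ => 0)) (fun _ _ => 0).
Proof.
by apply: cohomologous_eq (cohomologous_refl (fun _ _ => 0)) => *;
  rewrite /scale_form mulr0.
Qed.

Lemma cocycle_comb a b ga1 ga2 : cocycle br G ga1 -> cocycle br G ga2 ->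
  cocycle br G (fun L L' => a * ga1 L L' + b * ga2 L L').
Proof.
move=> [l1 s1 j1] [l2 s2 j2]; split=> [c L1 L2 L h1 h2 h|L L' h h'|L L' L'' h h' h''].
- by rewrite l1 // l2 //; ring.
- by rewrite s1 // s2 //; ring.
have := j1 L L' L'' h h' h''; have := j2 L L' L'' h h' h''.
set x := ga2 _ _; set y := ga2 _ _; set z := ga2 _ _.
set x1 := ga1 _ _; set y1 := ga1 _ _; set z1 := ga1 _ _ => e2 e1.
transitivity (a * (x1 + y1 + z1) + b * (x + y + z)); first by ring.
by rewrite e1 e2 !mulr0 addr0.
Qed.

Lemma cocycle0 : cocycle br G (fun _ _ => 0).
Proof. by split=> *; rewrite ?mulr0 ?oppr0 ?addr0. Qed.
End Cohomology.

(** What the cohomological argument uses of an almost-graded algebra [G]: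
    [homog m X] is the homogeneous element of degree [m] with leading coefficient
    [X] (of the projection of [X] to [g], for an arbitrary matrix), and [co L m] is
    the leading coefficient of the component of degree [m] of [L]. *)
Record graded_frame {C : numClosedFieldType} {V : lmodType C} {N : nat}
    (g : set 'M[C]_N) (br : V -> V -> V) (G : set V) (Gr : int -> set V)
    (homog : int -> 'M[C]_N -> V) (co : V -> int -> 'M[C]_N) : Prop :=
  GradedFrame {
  frame_linear : forall a L L', G L -> G L' -> G (a *: L + L');
  frame_br : forall L L', G L -> G L' -> G (br L L');
  frame_br_linear : forall a L L' L'',
    br (a *: L + L') L'' = (a *: br L L'' + br L' L'');
  frame_br_anti : forall L L', br L L' = (- br L' L);
  frame_jacobi : forall L L' L'',
    (br (br L L') L'' + br (br L' L'') L + br (br L'' L) L' = 0);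
  frame_homog : forall m X, G (homog m X);
  frame_homog_linear : forall m a X Y,
    homog m (a *: X + Y) = (a *: homog m X + homog m Y);
  frame_piece : forall m L, Gr m L <-> exists2 X, g X & L = homog m X;
  frame_ind : forall P : V -> Prop, P 0 ->
    (forall a L L', G L -> G L' -> P L -> P L' -> P (a *: L + L')) ->
    (forall m X, g X -> P (homog m X)) -> forall L, G L -> P L;
  frame_co_linear : forall a L L' m, G L -> G L' ->
    co (a *: L + L') m = (a *: co L m + co L' m);
  frame_co_homog : forall m X h, g X ->
    co (homog m X) h = if h == m then X else 0;
  frame_co_finite : forall L, G L -> exists b : nat, forall k : nat,
    (b <= k)%N -> co L (-1 - k%:Z) = 0;
  frame_bracket : forall m k X Y, g X -> g Y ->
    exists (r : nat) (F : 'I_r -> 'M[C]_N), (forall i, g (F i)) /\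
      br (homog m X) (homog k Y) =
      homog (m + k) (lie_bracket X Y) +
      \sum_(i < r) homog (m + k + 1 + (i : nat)%:Z) (F i) }.

Section Descent.
Context {C : numClosedFieldType} {V : lmodType C} {N : nat}.
Context {g : set 'M[C]_N} (pi : casimir_projection g).
Hypothesis g_simple : simple_lie_algebra g.
Variables (br : V -> V -> V) (G : set V) (Gr : int -> set V).
Variables (homog : int -> 'M[C]_N -> V) (co : V -> int -> 'M[C]_N).
Hypothesis frame : graded_frame g br G Gr homog co.
Implicit Types (ga : V -> V -> C) (X Y Z : 'M[C]_N) (l m n : int).
Local Notation coh := (cohomologous br G).

Lemma G0 : G 0.
Proof.
have := frame_linear frame (-1) (frame_homog frame 0 0) (frame_homog frame 0 0).
by rewrite scaleN1r addNr.
Qed.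

Lemma G_sum (I : finType) (F : I -> V) : (forall i, G (F i)) -> G (\sum_i F i).
Proof.
move=> GF; apply: (big_ind G) => // [|L L' GL GL']; first exact: G0.
by rewrite -[L]scale1r; apply: (frame_linear frame).
Qed.

Lemma cocycle_bilinear ga : cocycle br G ga ->
  (forall a L1 L2 L, G L1 -> G L2 -> G L ->
     ga L (a *: L1 + L2) = a * ga L L1 + ga L L2).
Proof.
move=> [l s _] a L1 L2 L G1 G2 GL.
rewrite s ?l //; last exact: (frame_linear frame).
by rewrite opprD -mulrN -!s.
Qed.

Lemma cocycle_sum_eq0 ga (I : finType) (F : I -> V) L : cocycle br G ga ->
  (forall i, G (F i)) -> G L -> (forall i, ga (F i) L = 0) ->
  ga (\sum_i F i) L = 0.
Proof.
move=> [l s _] GF GL F0.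
suff [] : G (\sum_i F i) /\ ga (\sum_i F i) L = 0 by [].
apply: (big_ind (fun x => G x /\ ga x L = 0)) => //.
  split; first exact: G0.
  by have := l (-1) _ _ _ G0 G0 GL; rewrite scaler0 addr0 mulN1r addNr.
move=> x y [Gx x0] [Gy y0]; split.
  by rewrite -[x]scale1r; apply: (frame_linear frame).
by rewrite -[x]scale1r l // x0 y0 mulr0 addr0.
Qed.

Definition vanish_above l ga := forall n m X Y, g X -> g Y ->
  l < n + m -> ga (homog n X) (homog m Y) = 0.

Lemma homog_bilinear n m ga : cocycle br G ga ->
  bilinear_form (fun X Y => ga (homog n X) (homog m Y)).
Proof.
move=> cg; have [l s _] := cg; have GL := frame_homog frame.
by split=> a X Y Z; rewrite (frame_homog_linear frame) ?l ?(cocycle_bilinear cg).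
Qed.

(** The components of higher degree of the bracket are paired with [Z_p] above the
    level where [ga] vanishes. *)
Lemma vanish_bracket ga n m p X Y Z : cocycle br G ga ->
  vanish_above (n + m + p) ga -> g X -> g Y -> g Z ->
  ga (br (homog n X) (homog m Y)) (homog p Z) =
  ga (homog (n + m) (lie_bracket X Y)) (homog p Z).
Proof.
move=> cg va gX gY gZ; have [l s _] := cg; have GL := frame_homog frame.
have [r [F [gF ->]]] := frame_bracket frame n m gX gY.
rewrite -[homog (n + m) _]scale1r l // ?mul1r; last exact: G_sum.
rewrite (cocycle_sum_eq0 cg) ?addr0 ?scale1r // => i.
by apply: va => //; lia.
Qed.

Lemma loop_of_cocycle l ga : cocycle br G ga -> vanish_above l ga ->
  loop_cocycle g l (fun n X Y => ga (homog n X) (homog (l - n) Y)).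
Proof.
move=> cg va; have [_ s j] := cg; have GL := frame_homog frame; split.
- by move=> n; apply: homog_bilinear.
- by move=> n X Y gX gY; rewrite s //; congr (- ga _ (homog _ _)); ring.
move=> n m p X Y Z nmp gX gY gZ.
have := j (homog n X) (homog m Y) (homog p Z) (GL _ _) (GL _ _) (GL _ _).
have v1 : vanish_above (n + m + p) ga by rewrite nmp.
have v2 : vanish_above (m + p + n) ga by rewrite (_ : m + p + n = l) // -nmp; ring.
have v3 : vanish_above (p + n + m) ga by rewrite (_ : p + n + m = l) // -nmp; ring.
rewrite !vanish_bracket //.
have -> : l - (n + m) = p by rewrite -nmp; ring.
have -> : l - (m + p) = n by rewrite -nmp; ring.
by have -> : l - (p + n) = m by rewrite -nmp; ring.
Qed.

Lemma sub_coboundary ga psi : cocycle br G ga -> linear_form_on G psi ->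
  cocycle br G (fun L L' => ga L L' - psi (br L L')) /\
  coh ga (fun L L' => ga L L' - psi (br L L')).
Proof.
move=> [l s j] lpsi; have Gb := frame_br frame.
split; last first.
  by exists psi => // L L' GL GL'; rewrite opprB addrC subrK.
have psiD L L' : G L -> G L' -> psi (L + L') = psi L + psi L'.
  by move=> GL GL'; have := lpsi 1 _ _ GL GL'; rewrite scale1r mul1r.
have psi0 : psi 0 = 0.
  by have := lpsi (-1) _ _ G0 G0; rewrite scaler0 addr0 mulN1r addNr.
have GD L L' : G L -> G L' -> G (L + L').
  by rewrite -{2}[L]scale1r; apply: (frame_linear frame).
split=> [c L1 L2 L h1 h2 h|L L' h h'|L L' L'' h h' h''].
- have [b1 b2] := (Gb _ _ h1 h, Gb _ _ h2 h).
  by rewrite (frame_br_linear frame) l // lpsi //; ring.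
- rewrite s // opprB addrC; congr (_ - _); rewrite (frame_br_anti frame).
  have := lpsi (-1) _ _ (Gb _ _ h' h) G0.
  by rewrite addr0 scaleN1r mulN1r psi0 addr0 => ->; rewrite opprK.
have [B1 B2 B3] : [/\ G (br (br L L') L''), G (br (br L' L'') L) & G (br (br L'' L)
  L')].
  by split; apply: (Gb) => //; apply: Gb.
have := j L L' L'' h h' h''; have := congr1 psi (frame_jacobi frame L L' L'').
rewrite psiD //; last exact: GD.
rewrite psiD // psi0 => e1 e2.
have regroup (x y z p1 p2 p3 : C) :
  (x - p1) + (y - p2) + (z - p3) = (x + y + z) - (p1 + p2 + p3) by ring.
by rewrite regroup e1 e2 subr0.
Qed.

(** The form to be composed with the component of degree [l] in order to cancel [ga]
    at level [l]: the Casimir potential of the derivation given by the pairs of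
    degrees [0] and [l]. *)
Definition level_form l ga : 'M[C]_N -> C :=
  casimir_potential pi (fun X Y => ga (homog 0 X) (homog l Y)).

Definition level_step l ga : V -> V -> C :=
  fun L L' => ga L L' - level_form l ga (co (br L L') l).

Lemma level_form_linear l ga a X Y : cocycle br G ga ->
  level_form l ga (a *: X + Y) = a * level_form l ga X + level_form l ga Y.
Proof. by move=> cg; apply: casimir_potential_linear; apply: homog_bilinear. Qed.

Lemma level_form0 l ga : cocycle br G ga -> level_form l ga 0 = 0.
Proof.
move=> cg; have := level_form_linear l (-1) 0 0 cg.
by rewrite scaler0 addr0 mulN1r addNr.
Qed.

Lemma level_step_cocycle l ga : cocycle br G ga ->
  cocycle br G (level_step l ga) /\ coh ga (level_step l ga).
Proof.
move=> cg; apply: (sub_coboundary (psi := fun L => level_form l ga (co L l))) => //.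
by move=> a L L' GL GL'; rewrite (frame_co_linear frame) // level_form_linear.
Qed.

Lemma co_bracket n m X Y h : g X -> g Y -> h <= n + m ->
  co (br (homog n X) (homog m Y)) h = if h == n + m then lie_bracket X Y else 0.
Proof.
move=> gX gY hnm; have GL := frame_homog frame.
have [r [F [gF ->]]] := frame_bracket frame n m gX gY.
rewrite -[homog (n + m) _]scale1r (frame_co_linear frame) //; last exact: G_sum.
rewrite (frame_co_homog frame) ?scale1r; last exact: (proj_lie pi).
suff [] : G (\sum_(i < r) homog (n + m + 1 + (i : nat)%:Z) (F i)) /\
    co (\sum_(i < r) homog (n + m + 1 + (i : nat)%:Z) (F i)) h = 0 by move=> _ ->;
      rewrite addr0.
apply: (big_ind (fun L => G L /\ co L h = 0)) => //.
- split; first exact: G0.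
  by have := frame_co_linear frame (-1) h G0 G0; rewrite scaler0 addr0 scaleN1r addNr.
- move=> x y [Gx x0] [Gy y0]; rewrite -[x]scale1r; split;
    first exact: (frame_linear frame).
  by rewrite (frame_co_linear frame) // x0 y0 scaler0 addr0.
move=> i _; split=> //; rewrite (frame_co_homog frame) //.
by case: eqP => // e; exfalso; lia.
Qed.

(** The coboundary subtracted at level [l] does not disturb the higher levels,
    because a bracket has no component below the sum of the degrees. *)
Lemma level_stepE l ga : cocycle br G ga -> vanish_above l ga ->
  vanish_above l (level_step l ga) /\
  exists2 a, l != 0 -> a = 0 & forall n X Y, g X -> g Y ->
    level_step l ga (homog n X) (homog (l - n) Y) = a * n%:~R * \tr (X *m Y).
Proof.
move=> cg va; split.
  move=> n m X Y gX gY lnm; rewrite /level_step va // co_bracket //; last exact: ltW.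
  by rewrite lt_eqF // level_form0 // subr0.
have [a a0 aE] := loop_cocycleE pi g_simple (loop_of_cocycle cg va).
exists a => // n X Y gX gY; rewrite /level_step aE //= subr0 co_bracket //;
  last first.
  by rewrite addrC subrK.
by rewrite [n + _]addrC subrK eqxx -[casimir_potential _ _ _]/(level_form l ga _)
  addrC addKr.
Qed.

Lemma level_step_vanish l ga : cocycle br G ga -> vanish_above l ga ->
  l != 0 -> vanish_above (l - 1) (level_step l ga).
Proof.
move=> cg va l0; have [va' [a a0 aE]] := level_stepE cg va.
move=> n m X Y gX gY lnm; case: (ltP l (n + m)) => [|nml]; first exact: va'.
have -> : m = l - n by lia.
by rewrite aE // a0 // !mul0r.
Qed.

Lemma reduce_above_zero (d : nat) ga : cocycle br G ga -> vanish_above d%:Z ga ->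
  exists2 ga', cocycle br G ga' /\ vanish_above 0 ga' & coh ga ga'.
Proof.
elim: d ga => [|d IHd] ga cg va; first by exists ga => //; apply: cohomologous_refl.
have va' := level_step_vanish cg va isT.
have [cg' coh'] := level_step_cocycle d.+1%:Z cg.
have [|ga' cga' coh''] := IHd _ cg'; first by rewrite (_ : d%:Z = d.+1%:Z - 1) //;
  lia.
by exists ga' => //; apply: cohomologous_trans coh''.
Qed.

(** Successive cancellation of the levels [-1], [-2], ...; the form used at each
    level depends on the cocycle left by the preceding steps. *)
Fixpoint descent ga (k : nat) : V -> V -> C :=
  if k is j.+1 then level_step (-1 - j%:Z) (descent ga j) else ga.

Lemma descentP ga k : cocycle br G ga -> vanish_above (-1) ga ->
  cocycle br G (descent ga k) /\ vanish_above (-1 - k%:Z) (descent ga k).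
Proof.
move=> cg va; elim: k => [|k [IHc IHv]] /=; first by rewrite subr0.
split; first by have [] := level_step_cocycle (-1 - k%:Z) IHc.
have -> : -1 - k.+1%:Z = -1 - k%:Z - 1 :> int by lia.
by apply: level_step_vanish => //; lia.
Qed.

Lemma descentE ga k L L' : descent ga k L L' = ga L L' -
  \sum_(j < k) level_form (-1 - j%:Z) (descent ga j) (co (br L L') (-1 - j%:Z)).
Proof.
elim: k => [|k IHk] /=; first by rewrite big_ord0 subr0.
by rewrite big_ord_recr /= /level_step IHk opprD addrA.
Qed.

(** The linear form is the sum of all the forms met in the descent, each applied
    to the component of its own degree.  On a given element the sum is finite. *)
Lemma negative_coboundary ga : cocycle br G ga -> vanish_above (-1) ga ->
  coh ga (fun _ _ => 0).
Proof.
move=> cg va; have dP k := descentP k cg va.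
pose term L (j : nat) := level_form (-1 - j%:Z) (descent ga j) (co L (-1 - j%:Z)).
have term0 L j : co L (-1 - j%:Z) = 0 -> term L j = 0.
  by rewrite /term => ->; rewrite level_form0 //; case: (dP j).
(* b L bounds the negative degrees of L, so that psi is defined without limits *)
have /choice[b bP] : forall L, exists b : nat, G L -> forall k : nat,
    (b <= k)%N -> co L (-1 - k%:Z) = 0.
  move=> L; have [GL|nGL] := pselect (G L); last by exists 0%N.
  by have [b hb] := frame_co_finite frame GL; exists b.
pose psi L := \sum_(j < b L) term L j.
have psiE L (d : nat) : G L -> (forall j : nat, (d <= j)%N -> co L (-1 - j%:Z) = 0) ->
    psi L = \sum_(j < d) term L j.
  move=> GL dL; pose e := maxn d (b L).
  have widen c : (c <= e)%N -> (forall j : nat, (c <= j)%N -> co L (-1 - j%:Z) = 0) ->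
      \sum_(j < c) term L j = \sum_(j < e) term L j.
    move=> ce cL; rewrite (big_ord_widen _ (term L) ce) big_mkcond /=.
    apply: eq_bigr => j _; case: ltnP => // cj.
    by rewrite term0 // cL.
  by rewrite /psi !widen ?leq_maxr ?leq_maxl //; apply: bP.
have psil : linear_form_on G psi.
  move=> a L L' GL GL'; pose d := maxn (b L) (b L').
  have dL (j : nat) : (d <= j)%N -> co L (-1 - j%:Z) = 0.
    by rewrite geq_max => /andP[h _]; apply: bP.
  have dL' (j : nat) : (d <= j)%N -> co L' (-1 - j%:Z) = 0.
    by rewrite geq_max => /andP[_ h]; apply: bP.
  rewrite (psiE _ d GL) // (psiE _ d GL') // (psiE _ d) //.
  - rewrite mulr_sumr -big_split /=; apply: eq_bigr => j _.
    by rewrite /term (frame_co_linear frame) // level_form_linear //; case: (dP j).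
  - exact: (frame_linear frame).
  - by move=> j dj; rewrite (frame_co_linear frame) // dL // dL' // scaler0 addr0.
exists psi => // L L' GL GL'; rewrite subr0.
have [l s _] := cg; have Gb := frame_br frame; have GL0 := G0.
have Ghomog := frame_homog frame; have psi0 : psi 0 = 0.
  by have := psil (-1) _ _ G0 G0; rewrite scaler0 addr0 mulN1r addNr.
have br0l K : br 0 K = 0.
  by have := frame_br_linear frame (-1) 0 0 K; rewrite scaler0 addr0 scaleN1r addNr.
have brr a K1 K2 K : br K (a *: K1 + K2) = a *: br K K1 + br K K2.
  rewrite (frame_br_anti frame) (frame_br_linear frame) opprD -scalerN.
  by rewrite -!(frame_br_anti frame).
have br0r K : br K 0 = 0 by rewrite (frame_br_anti frame) br0l oppr0.
have ga0l K : G K -> ga 0 K = 0.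
  by move=> GK; have := l (-1) 0 0 K G0 G0 GK; rewrite scaler0 addr0 mulN1r addNr.
elim/(frame_ind frame): L / GL => [|a L1 L2 G1 G2 IH1 IH2|n X gX].
- by rewrite ga0l // br0l psi0.
- by rewrite l // (frame_br_linear frame) psil ?IH1 ?IH2 //; apply: Gb.
elim/(frame_ind frame): L' / GL' => [|a L1 L2 G1 G2 IH1 IH2|m Y gY].
- by rewrite s ?ga0l ?br0r ?psi0 ?oppr0.
- rewrite (cocycle_bilinear cg) //.
  by rewrite brr psil ?IH1 ?IH2 //; apply: Gb => //; apply: (frame_homog frame).
pose d := absz (n + m).
have [_ vd] := dP d; have := vd n m X Y gX gY; rewrite descentE => vd'.
rewrite (psiE _ d); first by apply/eqP; rewrite -subr_eq0 vd' //; lia.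
  by apply: Gb; apply: (frame_homog frame).
move=> j dj; rewrite co_bracket //; last by lia.
by case: eqP => // e; exfalso; lia.
Qed.
End Descent.
Arguments vanish_above {C V N} g homog l ga.

(** * Classification of local cocycles *)

Section Classification.
Context {C : numClosedFieldType} {V : lmodType C} {N : nat}.
Context {g : set 'M[C]_N} (pi : casimir_projection g).
Hypothesis g_simple : simple_lie_algebra g.
Variables (br : V -> V -> V) (G : set V) (Gr : int -> set V).
Variables (homog : int -> 'M[C]_N -> V) (co : V -> int -> 'M[C]_N).
Hypothesis frame : graded_frame g br G Gr homog co.
Implicit Types (ga : V -> V -> C).
Local Notation coh := (cohomologous br G).
Local Notation zero := (fun _ _ : V => 0 : C).

Lemma local_vanish ga : local Gr ga -> exists d : nat, vanish_above g homog d%:Z ga.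
Proof.
move=> [lo [hi gaP]]; exists (absz hi) => n m X Y gX gY hnm.
apply/eqP; apply: contraT => gan0.
have /andP[_ nmhi] : lo <= n + m <= hi.
  by apply: gaP gan0; apply/(frame_piece frame); [exists X | exists Y].
by exfalso; move: hnm nmhi; lia.
Qed.

Lemma local_reduction ga : cocycle br G ga -> local Gr ga ->
  exists ga' a, [/\ cocycle br G ga', coh ga ga', vanish_above g homog 0 ga' &
    forall n X Y, g X -> g Y ->
      ga' (homog n X) (homog (- n) Y) = a * n%:~R * \tr (X *m Y)].
Proof.
move=> cg /local_vanish[d vd].
have [ga1 [c1 v1] h1] := reduce_above_zero pi g_simple frame cg vd.
have [c2 h2] := level_step_cocycle pi frame 0 c1.
have [v2 [a _ aE]] := level_stepE pi g_simple frame c1 v1.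
exists (level_step pi br homog co 0 ga1), a; split=> //.
  exact: cohomologous_trans h2.
by move=> n X Y gX gY; rewrite -aE // sub0r.
Qed.

(** The combination that cancels the two coefficients of [n tr (X Y)] at level [0]
    vanishes from level [0] upwards. *)
Lemma local_dependent ga1 ga2 :
  cocycle br G ga1 -> local Gr ga1 -> cocycle br G ga2 -> local Gr ga2 ->
  exists a b, (a, b) != (0, 0) /\
    coh (fun L L' => a * ga1 L L' + b * ga2 L L') zero.
Proof.
move=> c1 l1 c2 l2.
have [de1 [a1 [d1 h1 v1 e1]]] := local_reduction c1 l1.
have [de2 [a2 [d2 h2 v2 e2]]] := local_reduction c2 l2.
have trivial_comb a b : a * a1 + b * a2 = 0 ->
    coh (fun L L' => a * ga1 L L' + b * ga2 L L') zero.
  move=> ab; apply: cohomologous_trans (cohomologous_comb a b h1 h2) _.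
  apply: (negative_coboundary pi g_simple frame); first exact: cocycle_comb.
  move=> n m X Y gX gY nm; have [nm0|nm0] := ltP 0 (n + m).
    by rewrite v1 // v2 // !mulr0 addr0.
  have -> : m = - n by lia.
  by rewrite e1 // e2 // !mulrA -!mulrDl ab !mul0r.
have [/eqP a10|a10] := boolP (a1 == 0).
  exists 1, 0; split; first by rewrite xpair_eqE oner_eq0.
  by apply: trivial_comb; rewrite a10 mulr0 mul0r addr0.
exists a2, (- a1); split; first by rewrite xpair_eqE oppr_eq0 (negPf a10) andbF.
by apply: trivial_comb; rewrite mulNr mulrC subrr.
Qed.

Lemma local_class_dependent ga1 ga2 :
  local_class br G Gr ga1 -> local_class br G Gr ga2 ->
  exists a b, (a, b) != (0, 0) /\
    coh (fun L L' => a * ga1 L L' + b * ga2 L L') zero.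
Proof.
move=> [de1 [c1 l1 h1]] [de2 [c2 l2 h2]].
have [a [b [ab0 h]]] := local_dependent c1 l1 c2 l2.
exists a, b; split=> //; apply: cohomologous_trans h.
exact: cohomologous_comb.
Qed.

Lemma solve_comb a b ga1 ga2 : a != 0 ->
  coh (fun L L' => a * ga1 L L' + b * ga2 L L') zero ->
  coh ga1 (scale_form (- (b / a)) ga2).
Proof.
move=> a0 h; apply: cohomologous_eq
  (cohomologous_comb a^-1 0 h (cohomologous_refl br G zero)).
by move=> L L' _ _; rewrite /scale_form; field.
Qed.

Lemma nontrivial_proportional ga1 ga2 :
  local_class br G Gr ga1 -> local_class br G Gr ga2 ->
  ~ coh ga2 zero -> exists a, coh ga1 (scale_form a ga2).
Proof.
move=> l1 l2 n2; have [a [b [ab0 h]]] := local_class_dependent l1 l2.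
have [/eqP a0|a0] := boolP (a == 0); last by exists (- (b / a)); apply: solve_comb.
case: n2; have b0 : b != 0.
  by apply: contra ab0 => /eqP b0; rewrite a0 b0.
have h' : coh (fun L L' => b * ga2 L L' + 0 * ga2 L L') zero.
  by apply: cohomologous_eq h => L L' _ _; rewrite a0; ring.
apply: cohomologous_trans (solve_comb b0 h') _.
by apply: cohomologous_eq (cohomologous_refl br G zero) => L L' _ _;
  rewrite /scale_form mul0r oppr0 mul0r.
Qed.

Lemma scale0_trivial ga : coh (scale_form 0 ga) zero.
Proof.
by apply: cohomologous_eq (cohomologous_refl br G zero) => L L' _ _;
  rewrite /scale_form mul0r.
Qed.

Lemma nontrivial_rescaled ga1 ga2 :
  local_class br G Gr ga1 -> local_class br G Gr ga2 ->
  ~ coh ga1 zero -> ~ coh ga2 zero ->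
  exists2 a, a != 0 & coh ga1 (scale_form a ga2).
Proof.
move=> l1 l2 n1 n2; have [a h] := nontrivial_proportional l1 l2 n2.
exists a => //; apply/eqP => a0; apply: n1; apply: cohomologous_trans h _.
by rewrite a0; apply: scale0_trivial.
Qed.

(** Any nontrivial local class, reduced to be bounded by zero, generates all the
    others; if there is none, the zero cocycle does. *)
Lemma universal_exists : exists ga0, universal_bounded br G Gr ga0.
Proof.
have [[ga [cg lg ng]]|triv] :=
  pselect (exists ga, [/\ cocycle br G ga, local Gr ga & ~ coh ga zero]).
  have [ga0 [_ [c0 h0 v0 _]]] := local_reduction cg lg.
  have l0 : local_class br G Gr ga0 by exists ga; split=> //; apply: cohomologous_sym.
  exists ga0; split=> //.
    move=> n m L L' nm /(frame_piece frame)[X gX ->] /(frame_piece frame)[Y gY ->].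
    exact: v0.
  move=> ga1 c1 l1; apply: nontrivial_proportional => //.
    by exists ga1; split=> //; apply: cohomologous_refl.
  by move=> t0; apply: ng; apply: cohomologous_trans t0.
exists zero; split=> //.
- exact: cocycle0.
- exists zero; split; [exact: cocycle0 | | exact: cohomologous_refl].
  by exists 0, 0 => n m L L' _ _; rewrite eqxx.
move=> ga c l; exists 0.
have h : coh ga zero by apply: contrapT => n; apply: triv; exists ga.
by apply: cohomologous_trans h (cohomologous_sym (scale0_trivial _)).
Qed.

Lemma universal_trivial ga0 ga : universal_bounded br G Gr ga0 ->
  coh ga0 zero -> local_class br G Gr ga -> coh ga zero.
Proof.
move=> [_ _ _ univ] h0 [de [cd ld hd]]; have [a ha] := univ _ cd ld.
apply: cohomologous_trans (cohomologous_trans hd ha) _.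
exact: cohomologous_trans (cohomologous_scale a h0) (cohomologous_scale0 br G a).
Qed.

(** When all local classes are trivial, two universal cocycles are cohomologous, with
    factor [1]; otherwise both are nontrivial, and proportional. *)
Lemma universal_unique ga0 ga1 :
  universal_bounded br G Gr ga0 -> universal_bounded br G Gr ga1 ->
  exists2 a, a != 0 & coh ga1 (scale_form a ga0).
Proof.
move=> u0 u1; have [_ l0 _ _] := u0; have [_ l1 _ _] := u1.
have [h0|n0] := pselect (coh ga0 zero).
  exists 1; first exact: oner_neq0.
  apply: cohomologous_trans (universal_trivial u0 h0 l1) _.
  apply: cohomologous_trans (cohomologous_sym h0) _.
  by apply: cohomologous_eq (cohomologous_refl br G ga0) => L L' _ _;
    rewrite /scale_form mul1r.
apply: nontrivial_rescaled => // h1; apply: n0.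
exact: universal_trivial u1 h1 l0.
Qed.
End Classification.

(** * Leading coefficients *)

Section Leading.
Local Open Scope classical_set_scope.
Context {C : numClosedFieldType} {S : riemann_surface C} (z : chart C S).
Implicit Types (f h : S -> C) (m k : int) (a b c : C).

Lemma near0_small : \forall w \near (0 : C)^', w != 0 /\ `|w| <= 1.
Proof.
have := @dnbhs0_le C C 1 ltr01; have := @nbhs_dnbhs_neq C 0.
by apply: filterS2.
Qed.

(** The constant of the bound may be taken nonnegative: in an ordered field that is
    not total, the given one is only known to be so after multiplication by
    a power of [`|w|]. *)
Lemma leading_bound f m a : leading z f m a <-> exists2 K : C, 0 <= K &
  \forall w \near (0 : C)^', `|f (chart_inv z w) - a * w ^ m| <= K * (`|w ^ m| *
    `|w|).
Proof.
split=> [[K KP]|[K K0 KP]].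
  exists `|K| => //; move: KP near0_small; apply: filterS2 => w Kw [w0 _].
  have /ger0_norm KM : 0 <= K * `|w ^ (m + 1)| by apply: le_trans Kw.
  by move: Kw; rewrite -KM normrM normr_id expfzDr // expr1z normrM.
exists K; move: KP near0_small; apply: filterS2 => w Kw [w0 _].
by rewrite expfzDr // expr1z normrM.
Qed.

Lemma leading_linear f h m a b c : leading z f m a -> leading z h m b ->
  leading z (fun x => c * f x + h x) m (c * a + b).
Proof.
move=> /leading_bound[K K0 fP] /leading_bound[K' K'0 hP]; apply/leading_bound.
exists (`|c| * K + K'); first by rewrite addr_ge0 // mulr_ge0.
move: fP hP; apply: filterS2 => w fw hw.
rewrite (_ : _ - _ = c * (f (chart_inv z w) - a * w ^ m) +
                     (h (chart_inv z w) - b * w ^ m)); last by ring.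
apply: le_trans (ler_normD _ _) _; rewrite mulrDl normrM -mulrA.
by apply: lerD => //; apply: ler_wpM2l.
Qed.

Lemma leading_mul f h m k a b : leading z f m a -> leading z h k b ->
  leading z (fun x => f x * h x) (m + k) (a * b).
Proof.
move=> /leading_bound[K K0 fP] /leading_bound[K' K'0 hP]; apply/leading_bound.
exists (K * K' + `|a| * K' + `|b| * K).
  by rewrite !addr_ge0 ?mulr_ge0.
move: fP hP near0_small; apply: filterS3 => w fw hw [w0 w1].
rewrite expfzDr // normrM; set F := f _; set H := h _.
set M := w ^ m in fw *; set Q := w ^ k in hw *.
rewrite (_ : F * H - _ = (F - a * M) * (H - b * Q) + a * M * (H - b * Q)
   + b * Q * (F - a * M)); last by ring.
apply: le_trans (ler_normD _ _) _; rewrite ![in leRHS]mulrDl; apply: lerD; last first.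
  rewrite !normrM (_ : `|b| * K * _ = `|b| * `|Q| * (K * (`|M| * `|w|)));
    last by ring.
  by apply: ler_wpM2l => //; apply: mulr_ge0.
apply: le_trans (ler_normD _ _) _; apply: lerD; last first.
  rewrite !normrM (_ : `|a| * K' * _ = `|a| * `|M| * (K' * (`|Q| * `|w|)));
    last by ring.
  by apply: ler_wpM2l => //; apply: mulr_ge0.
rewrite normrM; apply: le_trans (ler_pM _ _ fw hw) _ => //.
rewrite [leLHS](_ : _ = (K * K' * (`|M| * `|Q|) * `|w|) * `|w|); last by ring.
rewrite [leRHS]mulrA -[leRHS]mulr1; apply: ler_wpM2l => //.
by rewrite !mulr_ge0.
Qed.

Lemma leading_higher f m k a : m < k -> leading z f k a -> leading z f m 0.
Proof.
move=> mk /leading_bound[K K0 fP]; apply/leading_bound.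
exists (K + `|a|); first by rewrite addr_ge0.
move: fP near0_small; apply: filterS2 => w fw [w0 w1].
have wk : `|w ^ k| <= `|w ^ m| * `|w|.
  have -> : k = m + 1 + (absz (k - m - 1)%R)%:Z by lia.
  rewrite !expfzDr // expr1z -exprnP !normrM normrX -[leRHS]mulr1.
  by apply: ler_wpM2l; rewrite ?mulr_ge0 ?exprn_ile1.
rewrite mul0r subr0 -[f _](subrK (a * w ^ k)).
apply: le_trans (ler_normD _ _) _; rewrite mulrDl; apply: lerD.
  apply: le_trans fw _; apply: ler_wpM2l => //.
  by apply: le_trans wk; rewrite -[leRHS]mulr1 ler_wpM2l.
by rewrite normrM ler_wpM2l.
Qed.

(** The difference of the leading coefficients is at most [K `|w|] for all small
    [w <> 0]. *)
Lemma leading_unique f m a b : leading z f m a -> leading z f m b -> a = b.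
Proof.
move=> fa fb; have := leading_linear (-1) fa fb.
move=> /leading_bound[K K0 P]; apply/eqP; rewrite eq_sym -subr_eq0;
  apply: contraT => ab.
have e0 : 0 < `|b - a| / (K + 1) by rewrite divr_gt0 ?normr_gt0 // ltr_wpDl.
have /filter_ex[w [abw we]] : \forall w \near (0 : C)^',
    `|b - a| <= K * `|w| /\ `|w| < `|b - a| / (K + 1).
  move: P (@dnbhs0_lt C C _ e0) near0_small; apply: filterS3 => w wP we [w0 _].
  split=> //; have M0 : 0 < `|w ^ m| by rewrite normr_gt0 expfz_neq0.
  move: wP; rewrite mulN1r addNr sub0r normrN normrM mulN1r (addrC (- a)).
  by rewrite [K * _]mulrCA mulrC ler_pM2l.
have : `|b - a| < `|b - a|.
  apply: le_lt_trans abw _.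
  apply: le_lt_trans (_ : _ <= (K + 1) * `|w|) _.
    by apply: ler_wpM2r => //; rewrite lerDl.
  by rewrite mulrC -ltr_pdivlMr // ltr_wpDl.
by rewrite ltxx.
Qed.

Lemma leading_near f h m a :
  (\forall w \near (0 : C)^', f (chart_inv z w) = h (chart_inv z w)) ->
  leading z f m a -> leading z h m a.
Proof.
move=> e [K fP]; exists K; move: e fP; apply: filterS2 => w <-.
by [].
Qed.
End Leading.

(** * Linearity of the Lax operator algebra *)

Section Laurent.
Local Open Scope classical_set_scope.
Context {C : numClosedFieldType} {S : riemann_surface C} (z : chart C S).
Implicit Types (f h : S -> C) (p : int) (a b : int -> C) (c : C).

Lemma laurent_linear f h p a b c : laurent z f p a -> laurent z h p b ->
  laurent z (fun x => c * f x + h x) p (fun k => c * a k + b k).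
Proof.
apply: filterS2 => w fw hw.
have -> : series (fun k : nat => (c * a (p + k%:Z) + b (p + k%:Z)) * w ^ (p + k%:Z)) =
    (fun n => c * series (fun k : nat => a (p + k%:Z) * w ^ (p + k%:Z)) n
       + series (fun k : nat => b (p + k%:Z) * w ^ (p + k%:Z)) n).
  apply/funext => n; rewrite /series /= mulr_sumr -big_split /=.
  by apply: eq_bigr => k _; rewrite mulrDl mulrA.
by apply: cvgD => //; apply: cvgM => //; apply: cvg_cst.
Qed.

(** Laurent series starting at different orders can only be added after padding
    with zero coefficients. *)
Lemma laurent_lower f p (d : nat) a : laurent z f (p + d%:Z) a ->
  laurent z f p (fun k => if k < p + d%:Z then 0 else a k).
Proof.
apply: filterS => w fw; rewrite -(cvg_shiftn d).
set u := [sequence _]_n.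
suff -> : u = series (fun k : nat => a (p + d%:Z + k%:Z) * w ^ (p + d%:Z + k%:Z)) by
  [].
apply/funext => n; rewrite /u /series /=.
rewrite (big_cat_nat _ (n := d)) ?leq_addl //= big_nat_cond big1 ?add0r; last first.
  by move=> i /andP[/andP[_ id] _]; rewrite ltrD2l ltz_nat id mul0r.
rewrite -{1}[d]add0n big_addn addnK; apply: eq_bigr => k _.
rewrite ltrD2l ltz_nat ltnNge leq_addl /= PoszD.
by rewrite (_ : p + (k%:Z + d%:Z) = p + d%:Z + k%:Z) //; ring.
Qed.

Lemma meromorphic_linear f h c : meromorphic_at z f -> meromorphic_at z h ->
  meromorphic_at z (fun x => c * f x + h x).
Proof.
move=> [p [a fP]] [q [b hP]]; pose m := Num.min p q.
have low r e u : m <= r -> laurent z u r e -> exists e', laurent z u m e'.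
  move=> mr uP; have er : r = m + (absz (r - m)%R)%:Z by lia.
  by rewrite er in uP; have := laurent_lower uP;
    exists (fun k => if k < m + (absz (r - m)%R)%:Z then 0 else e k).
have [|a' fP'] := low _ _ _ _ fP; first by rewrite ge_min lexx.
have [|b' hP'] := low _ _ _ _ hP; first by rewrite ge_min lexx orbT.
by exists m, (fun k => c * a' k + b' k); apply: laurent_linear.
Qed.

Lemma holomorphic_linear (E : set S) f h c : holomorphic_on E f -> holomorphic_on E h
  ->
  holomorphic_on E (fun x => c * f x + h x).
Proof.
move=> fP hP ch x ac dx Ex; rewrite /cderivable.
have := derivableD (derivableM (derivable_cst c _ _) (fP _ _ ac dx Ex)) (hP _ _ ac dx
  Ex).
by [].
Qed.
End Laurent.

Section LaxLinear.
Local Open Scope classical_set_scope.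
Context {C : numClosedFieldType} {g n : nat} {k : classical_type} (D : lax_data C g n
  k).
Variable (pi : casimir_projection (fin_algebra D)).
Local Notation S := (lax_surface D).
Local Notation N := (msize k n).

Lemma entry_linear a (L L' : S -> 'M[C]_N) i j :
  entry (a *: L + L') i j = (fun x => a * entry L i j x + entry L' i j x).
Proof. by apply/funext => x; rewrite /entry /= !mxE. Qed.

Lemma mx_laurent_linear z p a (L L' : S -> 'M[C]_N) A A' :
  mx_laurent z L p A -> mx_laurent z L' p A' ->
  mx_laurent z (a *: L + L') p (fun h => a *: A h + A' h).
Proof.
move=> h h' i j; rewrite entry_linear.
have := laurent_linear a (h i j) (h' i j); congr (laurent z _ _ _).
by apply/funext => m; rewrite !mxE.
Qed.

Lemma tyurin_linear al a A A' : tyurin D al A -> tyurin D al A' ->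
  tyurin D al (fun h => a *: A h + A' h).
Proof.
rewrite /tyurin; case: k D al A A' => D0 al A A'.
- move=> [be [ka [e1 e2 e3]]] [be' [ka' [f1 f2 f3]]].
  exists (a *: be + be'), (a * ka + ka'); split.
  + by rewrite e1 f1 linearP /= mulmxDr scalemxAr.
  + by rewrite linearP /= mulmxDl -scalemxAl e2 f2 scaler0 addr0.
  + by rewrite mulmxDl -scalemxAl e3 f3 scalerA scalerDl.
- move=> [be [ka [e1 e2 e3]]] [be' [ka' [f1 f2 f3]]].
  exists (a *: be + be'), (a * ka + ka'); split.
  + rewrite e1 f1 linearP /= mulmxDr mulmxDl -scalemxAr -scalemxAl scalerBr.
    by rewrite opprD addrACA.
  + by rewrite linearP /= mulmxDl -scalemxAl e2 f2 scaler0 addr0.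
  + by rewrite mulmxDl -scalemxAl e3 f3 scalerA scalerDl.
- move=> [be [nu [ka [e0 e1 e2 e3 e4]]]] [be' [nu' [ka' [f0 f1 f2 f3 f4]]]].
  exists (a *: be + be'), (a * nu + nu'), (a * ka + ka'); split.
  + by rewrite e0 f0 scalerA scalerDl.
  + rewrite e1 f1 scalemxAl -mulmxDl; congr (_ *m _).
    by rewrite linearP /= mulmxDr mulmxDl -scalemxAr -scalemxAl scalerDr addrACA.
  + by rewrite linearP /= !mulmxDl -!scalemxAl e2 f2 scaler0 addr0.
  + by rewrite mulmxDl -scalemxAl e3 f3 scalerA scalerDl.
  + by rewrite mulmxDr mulmxDl -scalemxAr -scalemxAl e4 f4 scaler0 addr0.
Qed.

Lemma lax_algebra_linear a L L' :
  lax_algebra D L -> lax_algebra D L' -> lax_algebra D (a *: L + L').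
Proof.
move=> [h1 h2 h3 h4 h5] [h1' h2' h3' h4' h5']; split.
- by move=> x; apply: (proj_closed pi); [apply: h1|apply: h1'].
- by move=> x mx /=; rewrite /GRing.add /= /GRing.scale /= h2 // h2' // scaler0 addr0.
- by move=> i j; rewrite entry_linear; apply: holomorphic_linear.
- move=> i j; rewrite entry_linear; have [u v] := h4 i j; have [u' v'] := h4' i j.
  by split; apply: meromorphic_linear.
move=> s; have [A [u v]] := h5 s; have [A' [u' v']] := h5' s.
exists (fun h => a *: A h + A' h); split; first exact: mx_laurent_linear.
exact: tyurin_linear.
Qed.

Lemma mx_leading_linear z m a (L L' : S -> 'M[C]_N) X X' :
  mx_leading z L m X -> mx_leading z L' m X' ->
  mx_leading z (a *: L + L') m (a *: X + X').
Proof.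
by move=> h h' i j; rewrite entry_linear !mxE; apply: leading_linear.
Qed.

Lemma leading0 z m : leading z (fun _ : S => 0 : C) m 0.
Proof. by exists 0; apply: filterE => w; rewrite mul0r subrr normr0 mul0r. Qed.

Lemma leading_sum z m (I : finType) (f : I -> S -> C) (a : I -> C) :
  (forall i, leading z (f i) m (a i)) ->
  leading z (fun x => \sum_i f i x) m (\sum_i a i).
Proof.
move=> fP; rewrite (_ : (fun x => _) = \sum_i f i); last first.
  by apply/funext => x; rewrite fct_sumE.
apply: (big_rec2 (fun u v => leading z u m v)) => [|i u v _ uv];
  first exact: leading0.
have := leading_linear 1 (fP i) uv; rewrite mul1r; congr (leading z _ m _).
by apply/funext => x; rewrite mul1r.
Qed.

Lemma mx_leading_bracket z m p (L L' : S -> 'M[C]_N) X X' :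
  mx_leading z L m X -> mx_leading z L' p X' ->
  mx_leading z (lax_bracket L L' : S -> 'M[C]_N) (m + p) (lie_bracket X X').
Proof.
move=> h h' i j.
have prod (P Q : S -> 'M[C]_N) q r Y Z :
    mx_leading z P q Y -> mx_leading z Q r Z ->
    leading z (fun x => (P x *m Q x) i j) (q + r) ((Y *m Z) i j).
  move=> hP hQ; rewrite mxE (_ : (fun x => _) = fun x => \sum_l P x i l * Q x l j).
    by apply: leading_sum => l; apply: leading_mul; [apply: hP|apply: hQ].
  by apply/funext => x; rewrite mxE.
have hh := prod _ _ _ _ _ _ h h'; have := prod _ _ _ _ _ _ h' h.
rewrite addrC => h'h; have := leading_linear (-1) h'h hh; congr (leading z _ _ _).
  by apply/funext => x; rewrite /entry /lax_bracket /lie_bracket !mxE mulN1r addrC.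
by rewrite /lie_bracket !mxE mulN1r addrC.
Qed.

End LaxLinear.

(** * Homogeneous elements and coordinates of Lax operators *)

Section LaxFrame.
Local Open Scope classical_set_scope.
Context {C : numClosedFieldType} {g n : nat} {k : classical_type} (D : lax_data C g n
  k).
Variable (pi : casimir_projection (fin_algebra D)).
Local Notation S := (lax_surface D).
Local Notation N := (msize k n).
Local Notation z := (zplus D).
Variable A : int -> S -> C.
Hypothesis generic : generic_position D A.
Local Notation fg := (fin_algebra D).
Local Notation G := (lax_algebra D).
Local Notation Gr := (lax_piece D A).

(** The marked points are finite in number, and closed in a Hausdorff surface; a
    coordinate centred at [P_+] avoids [P_+] itself outside [0]. *)
Lemma unmarked_near : \forall w \near (0 : C)^', ~ marked D (chart_inv z w).
Proof.
have [_ domP mapP] := zplus_coord D.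
pose F : set S := [set Pminus D] `|` range (@weak _ _ _ _ D).
have Fclosed : closed F.
  have /hausdorff_accessible/accessible_finite_set_closed := @surface_hausdorff C S.
  by apply; rewrite finite_setU; split; [exact: finite_set1 | exact: finite_image].
have FP : ~ F (Pplus D).
  by case=> [/Pplus_neq_Pminus|[s _ /weak_neq_Pplus]].
have img0 : (chart_map z @` chart_dom z) 0 by exists (Pplus D).
have inv0 : chart_inv z 0 = Pplus D by rewrite -mapP chart_mapK.
have opn := @chart_img_open C S z.
have cont := @chart_inv_cont C S z; rewrite continuous_open_subspace // in cont.
have {}cont := cont 0 (mem_set img0).
have nF : \forall w \near (0 : C), ~ F (chart_inv z w).
  have nbF : nbhs (chart_inv z 0) (~` F).
    by rewrite inv0; apply: open_nbhs_nbhs; split=> //; apply: closed_openC.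
  exact: (cont _ nbF).
have nI : \forall w \near (0 : C), (chart_map z @` chart_dom z) w.
  exact: open_nbhs_nbhs.
move: (nbhs_dnbhs nF) (nbhs_dnbhs nI) (nbhs_dnbhs_neq (0 : C)).
apply: filterS3 => w nFw [x dx xw] w0 [[/= wP|wQ]|wW].
- by move: wP; rewrite -xw chart_mapK // => xP; move: w0; rewrite -xw xP mapP eqxx.
- by apply: nFw; left.
- by apply: nFw; right.
Qed.

Lemma piece_in m L : Gr m L -> G L. Proof. by case. Qed.

Lemma piece_linear m a L L' : Gr m L -> Gr m L' -> Gr m (a *: L + L').
Proof.
move=> [GL hL] [GL' hL']; split; first exact: lax_algebra_linear.
move: hL hL'; case: asboolP => _.
  move=> [X gX LX] [X' gX' LX']; exists (a *: X + X'); first exact: (proj_closed pi).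
  move=> x mx; have -> : (a *: L + L') x = a *: L x + L' x by [].
  by rewrite LX // LX' // scalerDr !scalerA mulrC.
move=> [X [Y [gX gY lX lY]]] [X' [Y' [gX' gY' lX' lY']]].
exists (a *: X + X'), (a *: Y + Y').
by split; try exact: (proj_closed pi); apply: mx_leading_linear.
Qed.

(** When all [alpha s] vanish, the leading coefficient of [A m *: X] is [X], as
    [A m] is normalised at [P_+]. *)
Lemma piece_leading m L : Gr m L -> exists2 X, fg X & mx_leading z L m X.
Proof.
move=> [_]; case: asboolP => [triv|_]; last by move=> [X [Y [gX _ lX _]]]; exists X.
move=> [X gX LX]; exists X => // i j.
have [/(_ triv) [_ /(_ m) Am _ _] _ _ _] := generic.
have := leading_linear (X i j) Am (leading0 z m).
rewrite mulr1 addr0; apply: leading_near.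
move: unmarked_near; apply: filterS => w nm.
by rewrite /entry LX // !mxE addr0 mulrC.
Qed.

Lemma mx_leading_unique m (L : S -> 'M[C]_N) X Y :
  mx_leading z L m X -> mx_leading z L m Y -> X = Y.
Proof. by move=> h h'; apply/matrixP => i j; apply: leading_unique (h i j) (h' i j).
  Qed.

Lemma homog_exists : exists homog : int -> 'M[C]_N -> S -> 'M[C]_N,
  (forall m X, Gr m (homog m X) /\ mx_leading z (homog m X) m (pi X)) /\
  (forall m X L, Gr m L -> mx_leading z L m (pi X) -> L = homog m X).
Proof.
have [_ _ uniq _] := generic.
have ex m X : exists L, (Gr m L /\ mx_leading z L m (pi X)) /\
    (forall L', Gr m L' -> mx_leading z L' m (pi X) -> L' = L).
  have [L [LP Lu]] := uniq (pi X) m (proj_in pi X).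
  by exists L; split=> // L' h h'; rewrite (Lu L').
exists (fun m X => projT1 (cid (ex m X))).
split=> [m X|m X L]; case: cid => /= L' [h u]; [exact: h | exact: u].
Qed.

Variable homog : int -> 'M[C]_N -> S -> 'M[C]_N.
Hypothesis homogP : forall m X, Gr m (homog m X) /\ mx_leading z (homog m X) m (pi X).
Hypothesis homogU : forall m X L, Gr m L -> mx_leading z L m (pi X) -> L = homog m X.

Lemma homog_linear m a X Y : homog m (a *: X + Y) = a *: homog m X + homog m Y.
Proof.
have [h l] := homogP m X; have [h' l'] := homogP m Y.
apply/esym/homogU; first exact: piece_linear.
by rewrite linearP; apply: mx_leading_linear.
Qed.

Lemma pieceP m L : Gr m L <-> exists2 X, fg X & L = homog m X.
Proof.
split=> [GL|[X _ ->]]; last by case: (homogP m X).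
have [X gX lX] := piece_leading GL; exists X => //.
by apply: homogU => //; rewrite (proj_id pi).
Qed.

Lemma homog0 m : homog m 0 = 0.
Proof. by have := homog_linear m (-1) 0 0; rewrite scaler0 addr0 scaleN1r addNr. Qed.

Lemma homog_inj m X Y : fg X -> fg Y -> homog m X = homog m Y -> X = Y.
Proof.
move=> gX gY e; rewrite -(proj_id pi gX) -(proj_id pi gY).
have [_ l] := homogP m X; have [_ l'] := homogP m Y; rewrite e in l.
exact: mx_leading_unique l l'.
Qed.

Lemma lax_algebra0 : G 0.
Proof.
have [/piece_in h _] := homogP 0 0; have := lax_algebra_linear pi (-1) h h.
by rewrite scaleN1r addNr.
Qed.

Lemma lax_algebra_sum (I : Type) (s : seq I) (F : I -> S -> 'M[C]_N) :
  (forall i, G (F i)) -> G (\sum_(i <- s) F i).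
Proof.
move=> GF; apply: big_ind => // [|L L' h h']; first exact: lax_algebra0.
by rewrite -[L]scale1r; apply: lax_algebra_linear.
Qed.

Lemma sum_homog (c : int -> 'M[C]_N) (s : {fset int}) :
  (forall m, m \notin s -> c m = 0) ->
  \sum_(m \in [set: int]) homog m (c m) = \sum_(m <- s) homog m (c m).
Proof. by move=> cs; apply: fsbigTE => m ms; rewrite cs // homog0. Qed.

(** [c] lists the leading coefficients of the homogeneous components of [L]. *)
Definition coordinates (L : S -> 'M[C]_N) (c : int -> 'M[C]_N) : Prop :=
  [/\ forall m, fg (c m), exists s : {fset int}, forall m, m \notin s -> c m = 0 &
      L = \sum_(m \in [set: int]) homog m (c m)].

Lemma coordinates_exist L : G L -> exists c, coordinates L c.
Proof.
have [_ [_ dec] _ _] := generic.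
move=> /dec[F [[FG Ffin LF] _]].
have /choice[c cP] m : exists X, fg X /\ F m = homog m X.
  by have /pieceP[X gX FX] := FG m; exists X.
exists c; split; first by move=> m; case: (cP m).
  have /finite_fsetP[s sP] := Ffin; exists s => m ms; have [gc Fc] := cP m.
  apply: (@homog_inj m) => //; first by rewrite -(raddf0 pi); apply: proj_in.
  rewrite -Fc homog0; apply/eqP; apply: contraNT ms => Fm.
  by have : [set m | F m != 0] m by []; rewrite sP.
by rewrite LF; apply: eq_fsbigr => m _; case: (cP m).
Qed.

Lemma coordinates_unique L c c' : coordinates L c -> coordinates L c' -> c = c'.
Proof.
have [_ [_ dec] _ _] := generic.
have GL c1 : coordinates L c1 -> G L.
  move=> [_ [s sP] ->]; rewrite (sum_homog sP); apply: lax_algebra_sum => m.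
  by have [/piece_in] := homogP m (c1 m).
move=> h h'; have [F [_ Fu]] := dec L (GL _ h).
have coF c1 : coordinates L c1 -> F = (fun m => homog m (c1 m)).
  move=> [gc [s sP] Lc]; apply: Fu; split=> //.
    by move=> m; case: (homogP m (c1 m)).
  apply: (sub_finite_set (B := [set` s])) => [m /= cm|]; last exact: finite_fset.
  by apply: contraNT cm => /sP ->; rewrite homog0.
have e : (fun m => homog m (c m)) = (fun m => homog m (c' m)) by rewrite -!coF.
have [gc _ _] := h; have [gc' _ _] := h'.
by apply/funext => m; apply: (@homog_inj m) => //; move/(congr1 (@^~ m)): e.
Qed.

Lemma coordinates_linear a L L' c c' : coordinates L c -> coordinates L' c' ->
  coordinates (a *: L + L') (fun m => a *: c m + c' m).
Proof.
move=> [gc [s sP] Lc] [gc' [s' sP'] Lc'].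
have us m : m \notin (s `|` s')%fset -> c m = 0 /\ c' m = 0.
  by rewrite in_fsetU negb_or => /andP[h h']; rewrite sP // sP'.
split; first by move=> m; apply: (proj_closed pi).
  by exists (s `|` s')%fset => m /us[-> ->]; rewrite scaler0 addr0.
rewrite Lc Lc' (@sum_homog c (s `|` s')%fset); last by move=> m /us[].
rewrite (@sum_homog c' (s `|` s')%fset); last by move=> m /us[].
rewrite (@sum_homog _ (s `|` s')%fset); last by move=> m /us[-> ->];
  rewrite scaler0 addr0.
by rewrite scaler_sumr -big_split /=; apply: eq_bigr => m _; rewrite homog_linear.
Qed.

Lemma coordinates_homog m X : fg X ->
  coordinates (homog m X) (fun h => if h == m then X else 0).
Proof.
move=> gX; have nm h : h \notin [fset m]%fset -> (if h == m then X else 0) = 0.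
  by rewrite in_fset1 => /negPf ->.
split.
- by move=> h; case: ifP => // _; rewrite -(raddf0 pi); apply: proj_in.
- by exists [fset m]%fset.
by rewrite (sum_homog nm) big_seq_fset1 eqxx.
Qed.

Lemma lax_bracket_linear a (L L' L'' : S -> 'M[C]_N) :
  lax_bracket (a *: L + L') L'' =
  a *: (lax_bracket L L'' : S -> 'M[C]_N) + lax_bracket L' L''.
Proof. by apply/funext => x; apply: lie_bracket_linearl. Qed.

Lemma lax_bracketC (L L' : S -> 'M[C]_N) :
  lax_bracket L L' = - (lax_bracket L' L : S -> 'M[C]_N).
Proof. by apply/funext => x; rewrite /lax_bracket /= lie_bracketC. Qed.

(** The bracket lies in the pieces of degree at least [m + p].  Its leading
    coefficient at that order is [ [X, Y] ] by multiplicativity, and also that of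
    its component of degree [m + p], the other components being of higher order. *)
Lemma homog_bracket m p X Y : fg X -> fg Y ->
  exists (r : nat) (F : 'I_r -> 'M[C]_N), (forall i, fg (F i)) /\
    (lax_bracket (homog m X) (homog p Y) : S -> 'M[C]_N) =
    homog (m + p) (lie_bracket X Y) + \sum_(i < r) homog (m + p + 1 + (i : nat)%:Z)
      (F i).
Proof.
move=> gX gY; have [_ _ _ [r rP]] := generic.
have [hX lX] := homogP m X; have [hY lY] := homogP p Y.
have [F FG FE] := rP _ _ _ _ hX hY.
have /choice[c cP] i : exists Z, fg Z /\ F i = homog (m + p + (i : nat)%:Z) Z.
  by have /pieceP[Z gZ FZ] := FG i; exists Z.
have lF i : mx_leading z (F i) (m + p + (i : nat)%:Z) (c i).
  have [gc ->] := cP i; have [_] := homogP (m + p + (i : nat)%:Z) (c i).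
  by rewrite (proj_id pi gc).
have c0 : c ord0 = lie_bracket X Y.
  rewrite (proj_id pi gX) in lX; rewrite (proj_id pi gY) in lY.
  have lXY := mx_leading_bracket lX lY; rewrite FE in lXY.
  apply: mx_leading_unique lXY => i j.
  have -> : c ord0 i j = \sum_q (if q == ord0 then c q i j else 0).
    by rewrite -big_mkcond big_pred1_eq.
  rewrite (_ : entry _ i j = fun x => \sum_q entry (F q) i j x); last first.
    by apply/funext => x; rewrite /entry fct_sumE summxE.
  apply: leading_sum => q; case: eqP => [->|/eqP q0].
    by have := lF ord0 i j; rewrite addr0.
  apply: leading_higher (lF q i j).
  by rewrite ltrDl ltz_nat lt0n.
exists r, (fun i => c (fintype.lift ord0 i)); split; first by move=> i;
  case: (cP (fintype.lift ord0 i)).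
rewrite FE big_ord_recl; congr (_ + _).
  by have [_ ->] := cP ord0; rewrite addr0 c0.
apply: eq_bigr => i _; have [_ ->] := cP (fintype.lift ord0 i).
by rewrite fintype.lift0 intS addrA.
Qed.

Lemma homogeneous_frame :
  exists co, graded_frame fg (@lax_bracket C g n k D) G Gr homog co.
Proof.
have GL m X : G (homog m X) by have [/piece_in] := homogP m X.
have linG := lax_algebra_linear pi.
have /choice[co coP] : forall L, exists c, G L -> coordinates L c.
  move=> L; have [h|nh] := pselect (G L); last by exists (fun=> 0).
  by have [c cP] := coordinates_exist h; exists c.
have co_eq L c : G L -> coordinates L c -> co L = c.
  by move=> /coP; apply: coordinates_unique.
have ind (P : (S -> 'M[C]_N) -> Prop) : P 0 ->
    (forall a L L', G L -> G L' -> P L -> P L' -> P (a *: L + L')) ->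
    (forall m X, fg X -> P (homog m X)) -> forall L, G L -> P L.
  move=> P0 Plin Phomog L /coP[gc [s sP] ->]; rewrite (sum_homog sP).
  suff [] : G (\sum_(m <- s) homog m (co L m)) /\ P (\sum_(m <- s) homog m (co L m))
    by [].
  apply: (big_ind (fun L' => G L' /\ P L')).
  - by split=> //; apply: lax_algebra0.
  - move=> L1 L2 [h1 p1] [h2 p2]; rewrite -[L1]scale1r.
    by split; [apply: linG | apply: Plin].
  - by move=> m _; split; [apply: GL | apply: Phomog].
have br0 L : lax_bracket L 0 = 0 :> (S -> 'M[C]_N).
  by apply/funext => x; apply: lie_bracket0r.
exists co; split.
- exact: linG.
- move=> L L' GL1; elim/ind: L / GL1 L' => [L' _|a L1 L2 h1 h2 p1 p2 L' h|m X gX L'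
    h].
  + by rewrite lax_bracketC br0 oppr0; apply: lax_algebra0.
  + by rewrite lax_bracket_linear; apply: linG; [apply: p1|apply: p2].
  elim/ind: L' / h => [|a L1 L2 h1 h2 p1 p2|p Y gY].
  + by rewrite br0; apply: lax_algebra0.
  + rewrite (_ : lax_bracket _ _ = a *: (lax_bracket (homog m X) L1 : S -> 'M[C]_N) +
      (lax_bracket (homog m X) L2 : S -> 'M[C]_N)); first exact: linG.
    by apply/funext => x; apply: lie_bracket_linearr.
  have [r [F [_ ->]]] := homog_bracket m p gX gY.
  rewrite -[homog _ _]scale1r; apply: linG => //.
  exact: lax_algebra_sum.
- exact: lax_bracket_linear.
- exact: lax_bracketC.
- by move=> L L' L''; apply/funext => x; apply: lie_jacobi.
- exact: GL.
- by move=> m a X Y; apply: homog_linear.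
- exact: pieceP.
- exact: ind.
- move=> a L L' m h h'; rewrite (co_eq _ (fun m => a *: co L m + co L' m)) //;
    first exact: linG.
  by apply: coordinates_linear => //; apply: coP.
- move=> m X h gX; rewrite (co_eq _ (fun h => if h == m then X else 0)) //.
  exact: coordinates_homog.
- move=> L /coP[_ [s sP] _]; exists (\max_(m <- s) absz m)%N => j bj; apply: sP.
  apply/negP => js; have := @leq_bigmax_seq _ (s : seq int) xpredT absz _ js isT.
  by move=> /leq_trans/(_ bj); lia.
exact: homog_bracket.
Qed.
End LaxFrame.

Lemma lax_frame {C : numClosedFieldType} {g n : nat} {k : classical_type}
    (D : lax_data C g n k) (pi : casimir_projection (fin_algebra D))
    (A : int -> lax_surface D -> C) : generic_position D A ->
  exists homog co, graded_frame (fin_algebra D) (@lax_bracket C g n k D)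
    (lax_algebra D) (lax_piece D A) homog co.
Proof.
move=> generic; have [homog [homogP homogU]] := homog_exists pi generic.
by exists homog; apply: (homogeneous_frame generic homogP homogU).
Qed.

(** * Local cocycles on Lax operator algebras *)

Theorem theorem5p1 (R : realType) (g n : nat) (k : classical_type)
    (D : lax_data (CC R) g n k)
    (A : int -> lax_surface D -> CC R)
    (Hsimple : simple_lie_algebra (fin_algebra D))
    (Hgeneric : generic_position D A) :
  let G := lax_algebra D in
  let Gr := lax_piece D A in
  let br := @lax_bracket (CC R) g n k D in
  (exists2 ga0, universal_bounded br G Gr ga0 &
     forall ga1, universal_bounded br G Gr ga1 ->
       exists2 a, a != 0 & cohomologous br G ga1 (scale_form a ga0)) /\
  (forall ga1 ga2,
     cocycle br G ga1 -> cocycle br G ga2 ->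
     local_class br G Gr ga1 -> local_class br G Gr ga2 ->
     exists a b, (a, b) != (0, 0) /\
       cohomologous br G (fun L L' => a * ga1 L L' + b * ga2 L L')
                         (fun _ _ => 0)) /\
  (forall ga1 ga2,
     cocycle br G ga1 -> cocycle br G ga2 ->
     local_class br G Gr ga1 -> local_class br G Gr ga2 ->
     ~ cohomologous br G ga1 (fun _ _ => 0) ->
     ~ cohomologous br G ga2 (fun _ _ => 0) ->
     exists2 a, a != 0 & cohomologous br G ga1 (scale_form a ga2)).
Proof.
move=> G Gr br.
have pi : casimir_projection (fin_algebra D).
  apply: classical_casimir Hsimple.1.
  - exact: sigma_skew.
  - exact: sigma_nondeg.
have [homog [co frame]] := lax_frame pi Hgeneric.
split; last split.
- have [ga0 u0] := universal_exists pi Hsimple frame.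
  by exists ga0 => // ga1; apply: (universal_unique pi Hsimple frame u0).
- by move=> ga1 ga2 _ _; apply: (local_class_dependent pi Hsimple frame).
- by move=> ga1 ga2 _ _; apply: (nontrivial_rescaled pi Hsimple frame).
Qed.
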